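(* Let $n\ge 3$, let $\alpha,\beta\in\mathbb{R}$ with $\beta>0$, let $h^*:\mathbb{S}^{n-1}\to[-1,1]$ be a measurable function, and let $h=P_{\alpha,\beta}[h^*]$. Then $$|\nabla h(0)|\le \beta\,(1-|h(0)|^2).$$ The constant $\beta$ is sharp in this inequality: for fixed $n,\alpha,\beta$, it cannot be replaced by any smaller constant valid for all such $h$.
   Context: $\mathbb{B}^n$ is the open unit ball of $\mathbb{R}^n$, $\mathbb{S}^{n-1}$ the unit sphere, $|\cdot|$ the Euclidean norm. $\sigma^0$ is the rotation invariant Borel measure on $\mathbb{S}^{n-1}$ normalized by $\sigma^0(\mathbb{S}^{n-1})=1$. For $\alpha,\beta\in\mathbb{R}$, $\beta>0$, the generalized Poisson kernel is $$P_{\alpha,\beta}(x,y)=\frac{(1-|x|^2)^\alpha}{|x-y|^{2\beta}},\qquad x\in\mathbb{B}^n,\ y\in\mathbb{S}^{n-1},$$ and for $f\in L^1(\mathbb{S}^{n-1})$, $P_{\alpha,\beta}[f](x)=\int_{\mathbb{S}^{n-1}}P_{\alpha,\beta}(x,y)f(y)\,d\sigma^0(y)$ for $x\in\mathbb{B}^n$. *)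

(* Defs.v *)
From HB Require Import structures.
From mathcomp Require Import all_boot all_order all_algebra.
From mathcomp Require Import all_classical all_reals all_analysis.

Set Implicit Arguments.
Unset Strict Implicit.
Unset Printing Implicit Defensive.

Import Order.TTheory GRing.Theory Num.Theory.
Import numFieldNormedType.Exports.

Local Open Scope classical_set_scope.
Local Open Scope ring_scope.

(* The canonical norm `|x| of 'rV[R]_n is the sup norm, so the Euclidean norm
   is defined here. Both norms induce the same topology, hence the same Borel
   sets and the same notion of differentiability. *)
Definition enorm (R : realType) (n : nat) (x : 'rV[R]_n) : R :=
  Num.sqrt (\sum_(i < n) x 0 i ^+ 2).

Definition usphere (R : realType) (n : nat) : set 'rV[R]_n :=
  [set y | enorm y = 1].
Arguments usphere R n : clear implicits.

Definition borel_rV (R : realType) (n : nat) :=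
  g_sigma_algebraType (@open 'rV[R]_n).

Definition is_rotation (R : realType) (n : nat) (U : 'M[R]_n) : Prop :=
  U *m U^T = 1%:M /\ \det U = 1.

(* A Borel measure on the sphere is represented by the Borel measure on R^n
   that it induces, i.e. one that vanishes outside the sphere. *)
Definition is_sphere_measure (R : realType) (n : nat)
    (sigma : {measure set (borel_rV R n) -> \bar R}) : Prop :=
  [/\ sigma (usphere R n) = 1%E,
      sigma (~` usphere R n) = 0%E &
      forall (U : 'M[R]_n) (A : set (borel_rV R n)),
        is_rotation U -> measurable A ->
        sigma ((fun y : 'rV[R]_n => y *m U) @^-1` A) = sigma A].

Definition poisson_kernel (R : realType) (n : nat) (alpha beta : R)
    (x y : 'rV[R]_n) : R :=
  (1 - enorm x ^+ 2) `^ alpha / enorm (x - y) `^ (2 * beta).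

(* Meaningful for enorm x < 1 only: outside the open unit ball the bases of
   the powers above may vanish or be negative. *)
Definition poisson_ext (R : realType) (n : nat)
    (sigma : {measure set (borel_rV R n) -> \bar R}) (alpha beta : R)
    (f : 'rV[R]_n -> R) (x : 'rV[R]_n) : R :=
  \int[sigma]_(y in usphere R n) (poisson_kernel alpha beta x y * f y).

Definition gradient (R : realType) (n : nat) (h : 'rV[R]_n -> R)
    (x : 'rV[R]_n) : 'rV[R]_n :=
  \row_(i < n) 'D_(delta_mx 0 i) h x.

(* Only the values of f on the sphere matter. *)
Definition boundary_data (R : realType) (n : nat) (f : 'rV[R]_n -> R) : Prop :=
  measurable_fun (usphere R n : set (borel_rV R n)) f /\
  (forall y, usphere R n y -> -1 <= f y <= 1).

(* Main.v *)
Require Import Defs.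
From HB Require Import structures.
From mathcomp Require Import all_boot all_order all_algebra.
From mathcomp Require Import all_classical all_reals all_analysis.
From mathcomp Require Import measurable_realfun ring lra.

Set Implicit Arguments.
Unset Strict Implicit.
Unset Printing Implicit Defensive.

Import Order.TTheory GRing.Theory Num.Theory.
Import numFieldNormedType.Exports.

Local Open Scope classical_set_scope.
Local Open Scope ring_scope.

(** Expanding the kernel at the origin gives [h 0 = E f] and
    [gradient h 0 = (2 * beta) *: G], where [f] is the boundary function, [E] the
    mean over the sphere and [G] the vector of the means [E (y_i * f)]; the factor
    [(1 - |x|^2)^alpha] is of second order and does not contribute. Testing
    [G] against a unit vector [l], the inequality becomes
    [2 * E ((l . y) * f) <= 1 - (E f)^2] for every [f] with values in [[-1, 1]]. With
    [f = 1 - 2 g] and [l] replaced by [- l] this is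
    [E ((l . y) * g) <= m * (1 - m)] where [0 <= g <= 1] and [m = E g].

    If [l . y] were uniformly distributed on [[-1, 1]], the best [g] of mean [m]
    would be the indicator of [l . y > 1 - 2 m], with equality. By Archimedes
    this is the case [n = 3]; for larger [n] the distribution of [l . y] is more
    concentrated at [0]. The bathtub argument ([mean_dot_le]) therefore only needs
    [E (max (l . y - c) 0) <= (1 - c)^2 / 4], the right-hand side being the value
    for the uniform distribution ([mean_hinge_le]).

    The only information on the measure is its invariance. By a reflection,
    [l . y] is distributed as a coordinate [t] ([mean_phi_dot]). An infinitesimal
    rotation in the plane of two axes, summed over the second axis, gives Stein's
    identity [(n - 1) E (t psi(t)) = E ((1 - t^2) psi'(t))] ([mean_stein]). Take for
    [psi] the solution of [((1 - t^2) psi)' = (1 - c)^2 / 4 - max (t - c) 0] that is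
    regular at [-1] and [1]. It is elementary, continuously differentiable and
    nondecreasing, and the identity turns the mean of the right-hand side
    into [(n - 3) E (t psi(t))], which is nonnegative because
    [(n - 1) E (t psi(t)) = E ((1 - t^2) psi'(t))].

    For sharpness let [f = 1 - 2 g] with [g] the indicator of the cap
    [l . y > s], of measure [m]. Then [|G| >= 2 s m] while
    [1 - (E f)^2 <= 4 m], so a constant [C] must satisfy [C >= beta s], and [s] may
    be taken close to [1]. This uses [m > 0], which holds because all caps of the
    same height have the same measure and finitely many of them cover the
    sphere ([cap_gt0]). *)

(** * The Euclidean inner product *)

Definition dot (R : realType) (n : nat) (x y : 'rV[R]_n) : R :=
  \sum_(i < n) x 0 i * y 0 i.

Section EuclideanSpace.
Context {R : realType} {n : nat}.
Implicit Types x y z : 'rV[R]_n.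

Lemma dotC x y : dot x y = dot y x.
Proof. by apply: eq_bigr => i _; rewrite mulrC. Qed.

Lemma dotDl x y z : dot (x + y) z = dot x z + dot y z.
Proof. by rewrite -big_split; apply: eq_bigr => i _; rewrite mxE mulrDl. Qed.

Lemma dotZl a x y : dot (a *: x) y = a * dot x y.
Proof. by rewrite mulr_sumr; apply: eq_bigr => i _; rewrite mxE mulrA. Qed.

Lemma dotBl x y z : dot (x - y) z = dot x z - dot y z.
Proof. by rewrite dotDl -scaleN1r dotZl mulN1r. Qed.

Lemma dotDr x y z : dot x (y + z) = dot x y + dot x z.
Proof. by rewrite dotC dotDl !(dotC x). Qed.

Lemma dotBr x y z : dot x (y - z) = dot x y - dot x z.
Proof. by rewrite dotC dotBl !(dotC x). Qed.

Lemma dotZr a x y : dot x (a *: y) = a * dot x y.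
Proof. by rewrite dotC dotZl dotC. Qed.

Lemma dot_delta x i : dot x (delta_mx 0 i) = x 0 i.
Proof.
rewrite /dot (bigD1 i)//= !mxE !eqxx mulr1 big1 ?addr0// => j ji.
by rewrite mxE (negbTE ji) andbF mulr0.
Qed.

Lemma dot_ge0 x : 0 <= dot x x.
Proof. by apply: sumr_ge0 => i _; rewrite -expr2 sqr_ge0. Qed.

Lemma dot_eq0 x : (dot x x == 0) = (x == 0).
Proof.
apply/idP/eqP => [|->]; last by rewrite /dot big1// => i _; rewrite mxE mul0r.
rewrite psumr_eq0; last by move=> i _; rewrite -expr2 sqr_ge0.
move=> /allP h; apply/rowP => i; rewrite mxE; apply/eqP.
by have := h i; rewrite mem_index_enum mulf_eq0 orbb; exact.
Qed.

Lemma dot_mulmx x y : dot x y = (x *m y^T) 0 0.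
Proof. by rewrite mxE; apply: eq_bigr => i _; rewrite mxE. Qed.

Lemma enorm_ge0 x : 0 <= enorm x.
Proof. exact: sqrtr_ge0. Qed.

Lemma sqr_enorm x : enorm x ^+ 2 = dot x x.
Proof. by rewrite sqr_sqrtr ?dot_ge0// sumr_ge0// => i _; rewrite sqr_ge0. Qed.

Lemma enorm_sqrt x : enorm x = Num.sqrt (dot x x).
Proof. by rewrite -sqr_enorm sqrtr_sqr ger0_norm ?enorm_ge0. Qed.

Lemma enorm_gt0 x : x != 0 -> 0 < enorm x.
Proof.
by move=> x0; rewrite lt_def enorm_ge0 andbT -sqrf_eq0 sqr_enorm dot_eq0.
Qed.

Lemma enormZ a x : 0 <= a -> enorm (a *: x) = a * enorm x.
Proof.
move=> a0; rewrite !enorm_sqrt dotZl dotZr mulrA -expr2 sqrtrM ?sqr_ge0//.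
by rewrite sqrtr_sqr ger0_norm.
Qed.

Lemma usphereP x : usphere R n x <-> dot x x = 1.
Proof.
rewrite /usphere/= enorm_sqrt; split => [h|->]; last by rewrite sqrtr1.
by rewrite -[LHS]sqr_sqrtr ?dot_ge0// h expr1n.
Qed.

(** Cauchy-Schwarz, from the nonnegativity of the squared norm of
    [dot y y *: x - dot x y *: y]. *)
Lemma sqr_dot_le x y : dot x y ^+ 2 <= dot x x * dot y y.
Proof.
have [/eqP|y0] := eqVneq (dot y y) 0.
  rewrite dot_eq0 => /eqP ->.
  have -> : dot x 0 = 0 by rewrite /dot big1// => i _; rewrite mxE mulr0.
  by rewrite expr0n/= mulr_ge0 ?dot_ge0.
have ygt0 : 0 < dot y y by rewrite lt_def y0 dot_ge0.
have := dot_ge0 (dot y y *: x - dot x y *: y).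
rewrite dotBl !dotBr !dotZl !dotZr (dotC y x) => h.
have {}h : 0 <= dot y y * (dot x x * dot y y - dot x y ^+ 2).
  by apply: le_trans h _; rewrite le_eqVlt; apply/orP; left; apply/eqP; ring.
by move: h; rewrite pmulr_rge0// subr_ge0.
Qed.

Lemma norm_dot_le x y : `|dot x y| <= enorm x * enorm y.
Proof.
rewrite -(@ler_pXn2r _ 2)// ?nnegrE// ?mulr_ge0 ?enorm_ge0//.
by rewrite exprMn !sqr_enorm real_normK ?num_real ?sqr_dot_le.
Qed.

Lemma norm_coord_le x i : `|x 0 i| <= enorm x.
Proof.
rewrite -(dot_delta x i) (le_trans (norm_dot_le _ _))//.
rewrite [X in _ * X]enorm_sqrt dot_delta mxE !eqxx sqrtr1 mulr1//.
Qed.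

Lemma norm_dot_usphere x y : usphere R n x -> usphere R n y -> `|dot x y| <= 1.
Proof. by move=> /= hx hy; have := norm_dot_le x y; rewrite hx hy mulr1. Qed.

Lemma norm_coord_usphere y i : usphere R n y -> `|y 0 i| <= 1.
Proof. by move=> /= hy; have := norm_coord_le y i; rewrite hy. Qed.

Lemma usphereN x : usphere R n x -> usphere R n (- x).
Proof.
by move=> /usphereP hx; apply/usphereP; rewrite -scaleN1r dotZl dotZr hx; ring.
Qed.

Lemma usphere_delta i : usphere R n (delta_mx 0 i).
Proof. by apply/usphereP; rewrite dot_delta mxE !eqxx. Qed.

(** A crude comparison with the sup norm; the constant is positive even for
    [n = 0]. *)
Lemma enorm_le_norm x : enorm x <= (n%:R + 1) * `|x|.
Proof.
rewrite -(@ler_pXn2r _ 2)// ?nnegrE ?enorm_ge0 ?mulr_ge0 ?addr_ge0//.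
rewrite sqr_enorm exprMn; apply: (@le_trans _ _ (n%:R * `|x| ^+ 2)).
  rewrite /dot mulr_natl -[X in _ *+ X]card_ord -sumr_const.
  apply: ler_sum => i _; rewrite -expr2 -real_normK ?num_real//.
  rewrite ler_pXn2r ?nnegrE// [leRHS]/Num.norm/= mx_normrE.
  by apply/bigmax_geP; right => /=; exists (0, i).
by rewrite ler_wpM2r ?sqr_ge0//; have := ler0n R n; nra.
Qed.

End EuclideanSpace.

(** * Integration of bounded functions over the sphere *)

Section Borel.
Context {R : realType} {n : nat}.

Lemma open_borel_rV (A : set 'rV[R]_n) : open A ->
  measurable (A : set (borel_rV R n)).
Proof. exact: sub_sigma_algebra. Qed.

Lemma continuous_borel_rV (f : 'rV[R]_n -> R) : continuous f ->
  measurable_fun setT (f : borel_rV R n -> R).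
Proof.
move=> /continuousP cf; apply: (measurability _ (RGenOpens.measurableE R)).
move=> _ [_ [a [b ->] <-]]; rewrite setTI; apply: open_borel_rV.
by apply: cf; exact: interval_open.
Qed.

Lemma continuous_borel_rV2 (f : 'rV[R]_n -> 'rV[R]_n) : continuous f ->
  measurable_fun setT (f : borel_rV R n -> borel_rV R n).
Proof.
move=> /continuousP cf.
apply: (@measurability _ _ (borel_rV R n) (borel_rV R n) setT f
  (@open 'rV[R]_n)) => //.
by move=> _ [A oA <-]; rewrite setTI; apply: open_borel_rV; exact: cf.
Qed.

Lemma measurable_coord i : measurable_fun setT (fun y : borel_rV R n => y 0 i).
Proof. apply: continuous_borel_rV; exact: coord_continuous. Qed.

Lemma measurable_dot x : measurable_fun setT (fun y : borel_rV R n => dot x y).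
Proof.
apply: measurable_sum => i; apply: measurable_funM; last exact: measurable_coord.
exact: measurable_cst.
Qed.

Lemma measurable_sqr_dot : measurable_fun setT (fun y : borel_rV R n => dot y y).
Proof.
by apply: measurable_sum => i; apply: measurable_funM; exact: measurable_coord.
Qed.

Lemma measurable_usphere : measurable (usphere R n : set (borel_rV R n)).
Proof.
have -> : usphere R n = (fun y : borel_rV R n => dot y y) @^-1` [set 1].
  by apply/seteqP; split => y /=; rewrite -usphereP.
by rewrite -[X in measurable X]setTI; exact: measurable_sqr_dot.
Qed.

Lemma continuous_mulmxr (U : 'M[R]_n) : continuous (fun y : 'rV[R]_n => y *m U).
Proof.
have -> : (fun y : 'rV[R]_n => y *m U) = fun y => \sum_i y 0 i *: row i U.
  by apply/funext => y; rewrite mulmx_sum_row.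
apply: continuous_big => [|i _]; first exact: add_continuous.
exact: (fun x => cvgZr_tmp (@coord_continuous R 1 n 0 i x)).
Qed.

End Borel.

(** A class of integrands closed under the algebra below, on which the mean over
    the sphere is linear and monotone without integrability conditions. *)
Definition bounded_measurable (R : realType) (n : nat) (f : 'rV[R]_n -> R) :=
  measurable_fun (usphere R n : set (borel_rV R n)) f /\
  exists K, forall y, usphere R n y -> `|f y| <= K.

Section BoundedMeasurable.
Context {R : realType} {n : nat}.
Implicit Types f g : 'rV[R]_n -> R.

Lemma bm_cst (c : R) : bounded_measurable (fun _ : 'rV[R]_n => c).
Proof. by split; [exact: measurable_cst|exists `|c|]. Qed.

Lemma bmD f g : bounded_measurable f -> bounded_measurable g ->
  bounded_measurable (fun y => f y + g y).
Proof.
move=> [mf [K hK]] [mg [L hL]]; split; first exact: measurable_funD.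
exists (K + L) => y hy; rewrite (le_trans (ler_normD _ _))//.
by rewrite lerD ?hK ?hL.
Qed.

Lemma bmM f g : bounded_measurable f -> bounded_measurable g ->
  bounded_measurable (fun y => f y * g y).
Proof.
move=> [mf [K hK]] [mg [L hL]]; split; first exact: measurable_funM.
by exists (K * L) => y hy; rewrite normrM ler_pM ?hK ?hL.
Qed.

Lemma bmZ c f : bounded_measurable f -> bounded_measurable (fun y => c * f y).
Proof. by move=> bf; apply: bmM => //; exact: bm_cst. Qed.

Lemma bmB f g : bounded_measurable f -> bounded_measurable g ->
  bounded_measurable (fun y => f y - g y).
Proof.
move=> bf bg; have := bmD bf (bmZ (-1) bg).
by congr bounded_measurable; apply/funext => y; rewrite mulN1r.
Qed.

Lemma bm_sum (I : Type) (s : seq I) (P : pred I) (F : I -> 'rV[R]_n -> R) :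
  (forall i, P i -> bounded_measurable (F i)) ->
  bounded_measurable (fun y => \sum_(i <- s | P i) F i y).
Proof.
move=> bF; elim: s => [|i s IHs].
  have -> : (fun y => \sum_(i <- [::] | P i) F i y) = fun=> 0.
    by apply/funext => y; rewrite big_nil.
  exact: bm_cst.
have -> : (fun y => \sum_(j <- i :: s | P j) F j y) =
    fun y => (if P i then F i y else 0) + \sum_(j <- s | P j) F j y.
  by apply/funext => y; rewrite big_cons; case: ifP => _; rewrite ?add0r.
by apply: bmD => //; case Pi: (P i); [exact: bF|exact: bm_cst].
Qed.

Lemma bm_coord i : bounded_measurable (fun y : 'rV[R]_n => y 0 i).
Proof.
split; first exact: (measurable_funTS (measurable_coord i)).
by exists 1 => y; exact: norm_coord_usphere.
Qed.

Lemma bm_dot (l : 'rV[R]_n) : bounded_measurable (dot l).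
Proof. by apply: bm_sum => i _; apply: bmZ; exact: bm_coord. Qed.

Lemma bm_comp (phi : R -> R) f : measurable_fun setT phi ->
  (exists K, forall t, `|t| <= 1 -> `|phi t| <= K) ->
  measurable_fun (usphere R n : set (borel_rV R n)) f ->
  (forall y, usphere R n y -> `|f y| <= 1) ->
  bounded_measurable (fun y => phi (f y)).
Proof.
move=> mphi [K hK] mf f1; split; first exact: measurableT_comp.
by exists K => y hy; apply/hK/f1.
Qed.

Lemma boundary_data_bm f : boundary_data f -> bounded_measurable f.
Proof. by move=> [mf f1]; split => //; exists 1 => y /f1; rewrite ler_norml. Qed.

End BoundedMeasurable.

Definition sphere_mean (R : realType) (n : nat)
    (sigma : {measure set (borel_rV R n) -> \bar R}) (f : 'rV[R]_n -> R) : R :=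
  \int[sigma]_(y in usphere R n) f y.

Section SphereMean.
Context {R : realType} {n : nat} (sigma : {measure set (borel_rV R n) -> \bar R}).
Hypothesis hsigma : is_sphere_measure sigma.
Implicit Types f g : 'rV[R]_n -> R.

Local Notation E := (sphere_mean sigma).

Lemma bm_integrable f : bounded_measurable f ->
  sigma.-integrable (usphere R n) (EFin \o f).
Proof.
move=> [mf [K hK]]; apply: measurable_bounded_integrable => //.
- exact: measurable_usphere.
- by case: hsigma => -> _ _; rewrite ltry.
- exists `|K|; split; first exact: num_real.
  by move=> M KM y hy; exact: le_trans (hK y hy) (le_trans (ler_norm K) (ltW KM)).
Qed.

Lemma mean_eq f g : (forall y, usphere R n y -> f y = g y) -> E f = E g.
Proof. by move=> fg; apply: eq_Rintegral => y; rewrite inE; exact: fg. Qed.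

Lemma mean_cst c : E (fun=> c) = c.
Proof.
rewrite /sphere_mean Rintegral_cst; last exact: measurable_usphere.
by case: hsigma => -> _ _; rewrite mulr1.
Qed.

Lemma meanD f g : bounded_measurable f -> bounded_measurable g ->
  E (fun y => f y + g y) = E f + E g.
Proof.
move=> bf bg; rewrite /sphere_mean RintegralD//; first exact: measurable_usphere.
- exact: bm_integrable.
- exact: bm_integrable.
Qed.

Lemma meanB f g : bounded_measurable f -> bounded_measurable g ->
  E (fun y => f y - g y) = E f - E g.
Proof.
move=> bf bg; rewrite /sphere_mean RintegralB//; first exact: measurable_usphere.
- exact: bm_integrable.
- exact: bm_integrable.
Qed.

Lemma meanZ c f : bounded_measurable f -> E (fun y => c * f y) = c * E f.
Proof.
move=> bf; rewrite /sphere_mean RintegralZl//; first exact: measurable_usphere.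
exact: bm_integrable.
Qed.

Lemma mean_sum (I : Type) (s : seq I) (P : pred I) (F : I -> 'rV[R]_n -> R) :
  (forall i, P i -> bounded_measurable (F i)) ->
  E (fun y => \sum_(i <- s | P i) F i y) = \sum_(i <- s | P i) E (F i).
Proof.
move=> bF; elim: s => [|i s IHs].
  rewrite big_nil -[RHS](mean_cst 0); apply: mean_eq => y _.
  by rewrite big_nil.
rewrite big_cons -IHs; case: ifP => Pi.
  rewrite -meanD; [|exact: bF|exact: bm_sum].
  by apply: mean_eq => y _; rewrite big_cons Pi.
by apply: mean_eq => y _; rewrite big_cons Pi.
Qed.

Lemma mean_le f g : bounded_measurable f -> bounded_measurable g ->
  (forall y, usphere R n y -> f y <= g y) -> E f <= E g.
Proof.
move=> bf bg fg; apply: le_Rintegral => //; first exact: measurable_usphere.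
- exact: bm_integrable.
- exact: bm_integrable.
Qed.

Lemma mean_ge0 f : (forall y, usphere R n y -> 0 <= f y) -> 0 <= E f.
Proof. by move=> f0; apply: Rintegral_ge0. Qed.

Lemma norm_mean_le f K : bounded_measurable f ->
  (forall y, usphere R n y -> `|f y| <= K) -> `|E f| <= K.
Proof.
move=> bf fK; have bK c := bm_cst (n := n) c.
rewrite ler_norml -[- K]mean_cst -[X in _ && (_ <= X)]mean_cst.
by apply/andP; split; apply: mean_le => // y /fK; rewrite ler_norml => /andP[].
Qed.

End SphereMean.

(** * Invariance under reflections *)

Section Rotations.
Context {R : realType} {n : nat}.
Implicit Types (U : 'M[R]_n) (v y : 'rV[R]_n).

Lemma dot_mulmx_orthogonal U x y : U *m U^T = 1%:M ->
  dot (x *m U) (y *m U) = dot x y.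
Proof.
by move=> UU; rewrite !dot_mulmx trmx_mul mulmxA -(mulmxA x) UU mulmx1.
Qed.

Definition reflect v y : 'rV[R]_n := y - (2 * dot y v) *: v.

Definition reflect_mx v : 'M[R]_n := 1%:M - 2 *: (v^T *m v).

Lemma mul_reflect_mx v y : y *m reflect_mx v = reflect v y.
Proof.
rewrite mulmxBr mulmx1 -scalemxAr mulmxA /reflect -scalerA; congr (_ - _ *: _).
by rewrite [y *m v^T]mx11_scalar -dot_mulmx mul_scalar_mx.
Qed.

Lemma reflect_mx_orthogonal v : usphere R n v ->
  reflect_mx v *m (reflect_mx v)^T = 1%:M.
Proof.
move=> /usphereP hv.
have tr : (reflect_mx v)^T = reflect_mx v.
  by rewrite /reflect_mx linearB/= linearZ/= trmx1 trmx_mul trmxK.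
have K2 : v^T *m v *m (v^T *m v) = v^T *m v.
  by rewrite mulmxA -(mulmxA v^T) [v *m v^T]mx11_scalar -dot_mulmx hv mulmx1.
rewrite tr /reflect_mx mulmxBl mul1mx mulmxBr mulmx1 -scalemxAl -scalemxAr K2.
by apply/matrixP => i j; rewrite !mxE; ring.
Qed.

Definition flip_mx (k : 'I_n) : 'M[R]_n := diag_mx (\row_i (-1) ^+ (i == k)).

Lemma mul_flip_mx k y i : (y *m flip_mx k) 0 i = (-1) ^+ (i == k) * y 0 i.
Proof. by rewrite mul_mx_diag !mxE mulrC. Qed.

Lemma flip_mx_orthogonal k : flip_mx k *m (flip_mx k)^T = 1%:M.
Proof.
rewrite tr_diag_mx mulmx_diag -diag_const_mx; congr diag_mx.
by apply/rowP => i; rewrite !mxE -expr2 sqrr_sign.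
Qed.

Lemma det_flip_mx k : \det (flip_mx k) = -1.
Proof.
rewrite det_diag (bigD1 k)//= big1 => [|i ik]; rewrite mxE ?(negbTE ik)//.
by rewrite eqxx mulr1.
Qed.

(** An orthogonal matrix of determinant -1 becomes a rotation once a single
    coordinate of its values is negated. *)
Lemma orthogonal_rotation U k : U *m U^T = 1%:M ->
  exists2 V, is_rotation V & forall y i, i != k -> (y *m V) 0 i = (y *m U) 0 i.
Proof.
move=> UU; have : \det U ^+ 2 = 1 by rewrite expr2 -{2}det_tr -det_mulmx UU det1.
move=> /eqP; rewrite sqrf_eq1 => /orP[/eqP dU|/eqP dU]; first by exists U.
exists (U *m flip_mx k).
  split; last by rewrite det_mulmx dU det_flip_mx mulrNN mulr1.
  by rewrite trmx_mul mulmxA -(mulmxA U) flip_mx_orthogonal mulmx1.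
by move=> y i ik; rewrite mulmxA mul_flip_mx (negbTE ik) mul1r.
Qed.

End Rotations.

Section Invariance.
Context {R : realType} {n : nat} (sigma : {measure set (borel_rV R n) -> \bar R}).
Hypothesis hsigma : is_sphere_measure sigma.
Implicit Types (U : 'M[R]_n) (v y : 'rV[R]_n) (f : 'rV[R]_n -> R).

Local Notation E := (sphere_mean sigma).

Lemma preimage_usphere_rotation U : is_rotation U ->
  (fun y => y *m U) @^-1` usphere R n = usphere R n.
Proof.
move=> [UU _]; apply/seteqP; split => y /usphereP h; apply/usphereP; move: h;
  by rewrite dot_mulmx_orthogonal.
Qed.

(** The change of variables is done on the nonnegative [f y + K], with [K] a
    bound of [f]. *)
Lemma mean_rotation U f : is_rotation U -> bounded_measurable f ->
  E (fun y => f (y *m U)) = E f.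
Proof.
move=> hU [mf [K hK]].
pose phi (y : borel_rV R n) : borel_rV R n := y *m U.
have mphi : measurable_fun setT phi :=
  continuous_borel_rV2 (@continuous_mulmxr R n U).
pose phi_ : {mfun borel_rV R n >-> borel_rV R n} :=
  HB.pack phi (isMeasurableFun.Build _ _ _ _ _ mphi).
have mS := @measurable_usphere R n.
have phiS : phi @^-1` usphere R n = usphere R n by exact: preimage_usphere_rotation.
have Sphi y : usphere R n y -> usphere R n (y *m U) by rewrite -{1}phiS.
pose g y : R := f y + K.
have g0 y : usphere R n y -> 0 <= g y.
  by move=> /hK; rewrite ler_norml -lerBlDr sub0r => /andP[].
have mg : measurable_fun (usphere R n : set (borel_rV R n)) g.
  exact: measurable_funD.
have inv : E (fun y => g (phi y)) = E g.
  rewrite /sphere_mean; congr fine.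
  transitivity (\int[pushforward sigma phi_]_(y in usphere R n) (g y)%:E)%E.
    rewrite (@ge0_integral_pushforward _ _ _ _ _ phi mphi sigma (usphere R n)
      (EFin \o g))//.
    - by rewrite phiS.
    - exact/measurable_EFinP.
    - by move=> y; rewrite inE /= lee_fin; exact: g0.
  apply: eq_measure_integral => A mA _.
  by case: hsigma => _ _ /(_ U A hU mA).
have bf : bounded_measurable f by split => //; exists K.
have bfU : bounded_measurable (fun y => f (y *m U)).
  split; last by exists K => y /Sphi /hK.
  apply: (measurable_comp mS _ mf) => [_ /= [y yS <-]|].
    exact: Sphi.
  exact: measurable_funTS mphi.
move: inv; rewrite (meanD hsigma bfU (bm_cst K)) (meanD hsigma bf (bm_cst K)).
by move=> /addIr.
Qed.

(** Invariance passes from rotations to reflections for integrands that ignore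
    a coordinate, since the sign of that coordinate can correct the
    determinant. *)
Lemma mean_reflect v k f : usphere R n v -> bounded_measurable f ->
  (forall y z : 'rV[R]_n, (forall i, i != k -> y 0 i = z 0 i) -> f y = f z) ->
  E (fun y => f (reflect v y)) = E f.
Proof.
move=> hv bf fk.
have [V hV VE] := orthogonal_rotation k (reflect_mx_orthogonal hv).
rewrite -(mean_rotation hV bf); apply: mean_eq => y _; apply: fk => i ik.
by rewrite VE// mul_reflect_mx.
Qed.

Lemma reflect_usphere v y : usphere R n v -> usphere R n y ->
  usphere R n (reflect v y).
Proof.
move=> hv /usphereP hy; apply/usphereP; rewrite -mul_reflect_mx.
by rewrite dot_mulmx_orthogonal// reflect_mx_orthogonal.
Qed.

End Invariance.

(** * The distribution of a coordinate *)

(** Measurability is asked on the whole line, so that composition with a linear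
    form is immediate; the bound only where unit vectors take their coordinates. *)
Definition bm_itv (R : realType) (phi : R -> R) :=
  measurable_fun setT phi /\ exists K, forall t, `|t| <= 1 -> `|phi t| <= K.

Section Coordinates.
Context {R : realType} {n : nat} (sigma : {measure set (borel_rV R n) -> \bar R}).
Hypothesis hsigma : is_sphere_measure sigma.
Implicit Types (phi psi : R -> R) (v y l : 'rV[R]_n) (i j k : 'I_n).

Local Notation E := (sphere_mean sigma).

Lemma bm_phi_dot phi l : bm_itv phi -> usphere R n l ->
  bounded_measurable (fun y => phi (dot l y)).
Proof.
move=> [mphi hphi] hl; apply: bm_comp => //.
- exact: (measurable_funTS (measurable_dot l)).
- by move=> y; exact: norm_dot_usphere.
Qed.

Lemma bm_phi_coord phi i : bm_itv phi ->
  bounded_measurable (fun y : 'rV[R]_n => phi (y 0 i)).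
Proof.
move=> hphi; have := bm_phi_dot hphi (usphere_delta i).
by congr bounded_measurable; apply/funext => y; rewrite dotC dot_delta.
Qed.

Lemma reflect_coord v y i : reflect v y 0 i = y 0 i - 2 * dot y v * v 0 i.
Proof. by rewrite !mxE. Qed.

Lemma mean_coord i k : i != k -> E (fun y => y 0 i) = 0.
Proof.
move=> ik; have bi := @bm_coord R n i.
have := mean_reflect hsigma (k := k) (usphere_delta i) bi (fun y z h => h i ik).
have -> : E (fun y => reflect (delta_mx 0 i) y 0 i) = - E (fun y => y 0 i).
  rewrite -mulN1r -(meanZ hsigma _ bi); apply: mean_eq => y _.
  by rewrite reflect_coord dot_delta mxE !eqxx /=; ring.
by move=> h; lra.
Qed.

(** The reflection along the [j]-th axis changes the sign of the integrand. *)
Lemma mean_coord_odd phi i j k : bm_itv phi -> i != j -> i != k -> j != k ->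
  E (fun y => y 0 j * phi (y 0 i)) = 0.
Proof.
move=> hphi ij ik jk.
have bf : bounded_measurable (fun y : 'rV[R]_n => y 0 j * phi (y 0 i)).
  by apply: bmM; [exact: bm_coord|exact: bm_phi_coord].
have fk (y z : 'rV[R]_n) : (forall i, i != k -> y 0 i = z 0 i) ->
    y 0 j * phi (y 0 i) = z 0 j * phi (z 0 i) by move=> h; rewrite !h.
have := mean_reflect hsigma (usphere_delta j) bf fk.
have -> : E (fun y => reflect (delta_mx 0 j) y 0 j *
      phi (reflect (delta_mx 0 j) y 0 i)) =
    - E (fun y => y 0 j * phi (y 0 i)).
  rewrite -mulN1r -(meanZ hsigma _ bf); apply: mean_eq => y _.
  by rewrite !reflect_coord dot_delta !mxE !eqxx (negbTE ij) mulr0 subr0/=; ring.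
by move=> h; lra.
Qed.

(** The reflection across the bisector of [l] and the [i]-th axis exchanges
    them, so all linear coordinates have the same distribution. *)
Lemma mean_phi_dot phi l i k : bm_itv phi -> i != k -> usphere R n l ->
  E (fun y => phi (dot l y)) = E (fun y => phi (y 0 i)).
Proof.
move=> hphi ik hl; have [le|le] := eqVneq (delta_mx 0 i) l.
  by apply: mean_eq => y _; rewrite -le dotC dot_delta.
have /usphereP ll := hl.
pose w := delta_mx 0 i - l; pose r := enorm w.
have w0 : w != 0 by rewrite subr_eq0.
have ww : dot w w = 2 * w 0 i.
  by rewrite dotBr dotBl !dot_delta dotBl dotC dot_delta ll !mxE !eqxx/=; ring.
have r2 : r ^+ 2 = 2 * w 0 i by rewrite sqr_enorm.
have r0 : r != 0 by rewrite -sqrf_eq0 sqr_enorm dot_eq0.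
have hv : usphere R n (r^-1 *: w).
  by apply/usphereP; rewrite dotZl dotZr ww -r2; field.
have bf := bm_phi_coord i hphi.
have fk (y z : 'rV[R]_n) : (forall i, i != k -> y 0 i = z 0 i) ->
    phi (y 0 i) = phi (z 0 i).
  by move=> h; rewrite h.
rewrite -(mean_reflect hsigma hv bf fk); apply: mean_eq => y _; congr phi.
rewrite reflect_coord dotZr mxE.
have -> : 2 * (r^-1 * dot y w) * (r^-1 * w 0 i) = dot y w.
  have -> : 2 * (r^-1 * dot y w) * (r^-1 * w 0 i) =
      (r ^+ 2)^-1 * (2 * w 0 i) * dot y w.
    by rewrite -exprVn; ring.
  by rewrite -r2 mulVf ?mul1r// expf_neq0.
by rewrite dotBr dot_delta opprB addrCA subrr addr0 dotC.
Qed.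

(** The reflection along [(a, b)], in the plane of the axes [i] and [j], sends
    [(A, y)] to [(p * A - q * y, - (p * y + q * A))], with [p] and [q] the cosine and
    the sine of an angle of order [a]. So [y * psi A] becomes, up to sign, the
    first product below, whose expansion to first order in [q] is obtained by
    differentiating a rotation. The numbers [psiA], [dA] and [psiB] stand for the
    values of [psi] and of its derivative at [A], and of [psi] at [B]. *)
Lemma rotation_expansion (K M a b A y psiA dA psiB : R) :
  0 <= a -> a <= 1 / 2 -> 0 <= b -> a ^+ 2 + b ^+ 2 = 1 ->
  `|A| <= 1 -> `|y| <= 1 -> 0 <= K -> `|dA| <= M ->
  let p := 1 - 2 * a ^+ 2 in let q := 2 * a * b in let B := p * A - q * y in
  `|psiB - psiA - (B - A) * dA| <= K * (B - A) ^+ 2 ->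
  `|(p * y + q * A) * psiB - p * (y * psiA) - q * (A * psiA - y ^+ 2 * dA)| <=
    (10 * M + 32 * K) * a ^+ 2.
Proof.
move=> a0 a1 b0 ab A1 y1 K0 dM p q B hB.
have b1 : b <= 1 by nra.
have aa : a ^+ 2 <= 1 / 4 by nra.
have p0 : 0 <= p by rewrite /p; lra.
have p1 : p <= 1 by rewrite /p; nra.
have q0 : 0 <= q by rewrite /q; nra.
have q1 : q <= 2 * a by rewrite /q; nra.
have normM (u v r s : R) : `|u| <= r -> `|v| <= s -> `|u * v| <= r * s.
  by move=> *; rewrite normrM ler_pM.
have normD (u v r s : R) : `|u| <= r -> `|v| <= s -> `|u + v| <= r + s.
  by move=> *; rewrite (le_trans (ler_normD _ _))// lerD.
have np : `|p| <= 1 by rewrite ger0_norm.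
have nq : `|q| <= 2 * a by rewrite ger0_norm.
have np' : `|1 - p| <= 2 * a ^+ 2.
  have -> : 1 - p = 2 * a ^+ 2 by rewrite /p; ring.
  by rewrite ger0_norm// mulr_ge0// sqr_ge0.
have M0 : 0 <= M by rewrite (le_trans _ dM).
have BA : `|B - A| <= 4 * a.
  have -> : B - A = - (q * y) + - ((1 - p) * A) by rewrite /B; ring.
  have h1 : `|- (q * y)| <= 2 * a * 1 by rewrite normrN; exact: normM.
  have h2 : `|- ((1 - p) * A)| <= 2 * a ^+ 2 * 1 by rewrite normrN; exact: normM.
  by apply: le_trans (normD _ _ _ _ h1 h2) _; nra.
have BA2 : (B - A) ^+ 2 <= 16 * a ^+ 2.
  have -> : 16 * a ^+ 2 = (4 * a) ^+ 2 by ring.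
  by rewrite -[X in X <= _]real_normK ?num_real// ler_pXn2r// ?nnegrE// mulr_ge0.
pose rho := psiB - psiA - (B - A) * dA.
have hrho : `|rho| <= 16 * K * a ^+ 2.
  apply: le_trans hB _; nra.
pose G := q * (1 - p) * (y * y) + - (p * (1 - p) * (A * y)) +
  - (q * q * (A * y)) + - (q * (1 - p) * (A * A)).
have -> : (p * y + q * A) * psiB - p * (y * psiA) - q * (A * psiA - y ^+ 2 * dA)
    = G * dA + (p * y + q * A) * rho by rewrite /G /rho /B; ring.
have hpq : `|p * y + q * A| <= 2.
  apply: le_trans (normD _ _ _ _ (normM _ _ _ _ np y1) (normM _ _ _ _ nq A1)) _.
  lra.
have hG : `|G| <= 10 * a ^+ 2.
  have n1 := normM _ _ _ _ (normM _ _ _ _ nq np') (normM _ _ _ _ y1 y1).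
  have n2 := normM _ _ _ _ (normM _ _ _ _ np np') (normM _ _ _ _ A1 y1).
  have n3 := normM _ _ _ _ (normM _ _ _ _ nq nq) (normM _ _ _ _ A1 y1).
  have n4 := normM _ _ _ _ (normM _ _ _ _ nq np') (normM _ _ _ _ A1 A1).
  rewrite -normrN in n2; rewrite -normrN in n3; rewrite -normrN in n4.
  apply: le_trans (normD _ _ _ _ (normD _ _ _ _ (normD _ _ _ _ n1 n2) n3) n4) _.
  nra.
apply: le_trans (normD _ _ _ _ (normM _ _ _ _ hG dM) (normM _ _ _ _ hpq hrho)) _.
nra.
Qed.

End Coordinates.

Section Stein.
Context {R : realType} {n : nat} (sigma : {measure set (borel_rV R n) -> \bar R}).
Hypothesis hsigma : is_sphere_measure sigma.
Variables (psi dpsi : R -> R) (K : R).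
Hypotheses (hpsi : bm_itv psi) (hdpsi : bm_itv dpsi) (K0 : 0 <= K).
Hypothesis taylor : forall s t, `|s| <= 1 -> `|t| <= 1 ->
  `|psi t - psi s - (t - s) * dpsi s| <= K * (t - s) ^+ 2.

Local Notation E := (sphere_mean sigma).

(** The mean of [y 0 j * psi (y 0 i)] vanishes before and after the reflection
    along [(a, b)]. By [rotation_expansion] the mean of the first-order term is
    then [O(a)] for every small [a], hence zero. *)
Lemma mean_infinitesimal_rotation (i j k : 'I_n) : i != j -> i != k -> j != k ->
  E (fun y => y 0 i * psi (y 0 i) - y 0 j ^+ 2 * dpsi (y 0 i)) = 0.
Proof.
move=> ij ik jk; set G := fun y => _.
have bi := @bm_coord R n i; have bj := @bm_coord R n j.
have bpsi := bm_phi_coord i hpsi; have bdpsi := bm_phi_coord i hdpsi.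
have bG : bounded_measurable G.
  by apply: bmB; apply: bmM => //; exact: bmM.
pose F (y : 'rV[R]_n) := y 0 j * psi (y 0 i).
have bF : bounded_measurable F by exact: bmM.
have EF : E F = 0 by exact: mean_coord_odd ij ik jk.
have fk (y z : 'rV[R]_n) : (forall i, i != k -> y 0 i = z 0 i) -> F y = F z.
  by move=> h; rewrite /F !h.
have [_ [M hM]] := hdpsi.
have M0 : 0 <= M by rewrite (le_trans _ (hM 0 _))// normr0.
have bound a : 0 < a -> a <= 1 / 2 -> `|E G| <= (10 * M + 32 * K) * a.
  move=> a0 a12; have a0' := ltW a0.
  have a2 : a ^+ 2 <= 1 / 4 by nra.
  pose b := Num.sqrt (1 - a ^+ 2).
  have b0 : 0 <= b by exact: sqrtr_ge0.
  have ab : a ^+ 2 + b ^+ 2 = 1 by rewrite sqr_sqrtr; lra.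
  have b2 : b ^+ 2 = 1 - a ^+ 2 by lra.
  have b12 : 1 / 2 <= b by nra.
  pose v : 'rV[R]_n := a *: delta_mx 0 i + b *: delta_mx 0 j.
  have vi : v 0 i = a by rewrite !mxE !eqxx (negbTE ij)/=; ring.
  have vj : v 0 j = b by rewrite !mxE !eqxx eq_sym (negbTE ij)/=; ring.
  have yv y : dot y v = a * y 0 i + b * y 0 j by rewrite dotDr !dotZr !dot_delta.
  have hv : usphere R n v by apply/usphereP; rewrite yv vi vj -ab; ring.
  pose p := 1 - 2 * a ^+ 2; pose q := 2 * a * b.
  have Ri y : reflect v y 0 i = p * y 0 i - q * y 0 j.
    by rewrite reflect_coord yv vi /p /q; ring.
  have Rj y : reflect v y 0 j = - (p * y 0 j + q * y 0 i).
    by rewrite reflect_coord yv vj /p /q; ring: b2.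
  have EFv : E (fun y => F (reflect v y)) = 0.
    by rewrite (mean_reflect hsigma hv bF fk).
  have bFv : bounded_measurable (fun y => F (reflect v y)).
    pose l : 'rV[R]_n := p *: delta_mx 0 i - q *: delta_mx 0 j.
    have lE y : dot l y = p * y 0 i - q * y 0 j.
      by rewrite dotC dotBr !dotZr !dot_delta.
    have hl : usphere R n l.
      apply/usphereP; rewrite lE !mxE !eqxx (negbTE ij) eq_sym (negbTE ij)/= /p /q.
      by ring: b2.
    have -> : (fun y => F (reflect v y)) =
        (fun y => (- p) * y 0 j * psi (dot l y) - q * (y 0 i * psi (dot l y))).
      by apply/funext => y; rewrite /F Ri Rj lE; ring.
    have bl := bm_phi_dot hpsi hl.
    by apply: bmB; [apply: bmM => //; exact: bmZ|apply: bmZ; exact: bmM].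
  pose D y := - F (reflect v y) - p * F y - q * G y.
  have bN : bounded_measurable (fun y => - F (reflect v y)).
    have := bmZ (-1) bFv; congr bounded_measurable.
    by apply/funext => y; rewrite mulN1r.
  have ED : E D = - (q * E G).
    rewrite (meanB hsigma); [|apply: bmB => //|]; try exact: bmZ.
    rewrite (meanB hsigma)//; last exact: bmZ.
    rewrite !(meanZ hsigma)// EF mulr0 subr0.
    have -> : E (fun y => - F (reflect v y)) = E (fun y => -1 * F (reflect v y)).
      by apply: mean_eq => y _; rewrite mulN1r.
    by rewrite (meanZ hsigma)// EFv mulr0 sub0r.
  have bD : bounded_measurable D by apply: bmB; [apply: bmB => //|]; exact: bmZ.
  have : `|E D| <= (10 * M + 32 * K) * a ^+ 2.
    apply: (norm_mean_le hsigma bD) => y yS.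
    have yi := norm_coord_usphere i yS; have yj := norm_coord_usphere j yS.
    have yR := norm_coord_usphere i (reflect_usphere hv yS).
    rewrite Ri in yR.
    have := rotation_expansion a0' a12 b0 ab yi yj K0 (hM _ yi) (taylor yi yR).
    by rewrite /D /F /G Ri Rj -/p -/q mulNr opprK.
  rewrite ED normrN normrM ger0_norm; last by rewrite !mulr_ge0.
  move=> h; rewrite -(ler_pM2r a0) -mulrA -expr2; apply: le_trans h.
  by rewrite mulrC ler_wpM2r// /q -mulrA mulrCA ler_peMr//; lra.
apply/eqP; rewrite -normr_eq0; apply/negPn/negP => g0.
have {}g0 : 0 < `|E G| by rewrite lt_def g0 normr_ge0.
have := bound (Num.min (1 / 2) (`|E G| / (2 * (10 * M + 32 * K + 1)))).
set C := 10 * M + 32 * K; have C0 : 0 <= C by rewrite addr_ge0// mulr_ge0.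
have C1 : 0 < C + 1 by lra.
have C2 : 0 < 2 * (C + 1) by lra.
have half : 0 < 1 / 2 :> R by lra.
rewrite lt_min half ge_min lexx divr_gt0//= => /(_ isT isT) h.
have {}h : `|E G| <= C * (`|E G| / (2 * (C + 1))).
  apply: le_trans h _.
  by rewrite ler_wpM2l// ge_min lexx orbT.
have : C * (`|E G| / (2 * (C + 1))) < `|E G|.
  by rewrite mulrA ltr_pdivrMr//; nra.
by rewrite ltNge h.
Qed.

(** Stein's identity: the terms [y 0 j ^+ 2] of [mean_infinitesimal_rotation], over
    all [j] other than [i], add up to [1 - y 0 i ^+ 2]. *)
Lemma mean_stein (i : 'I_n) : (3 <= n)%N ->
  n.-1%:R * E (fun y => y 0 i * psi (y 0 i)) =
  E (fun y => (1 - y 0 i ^+ 2) * dpsi (y 0 i)).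
Proof.
move=> n3.
have bi := @bm_coord R n; have bpsi := bm_phi_coord i hpsi.
have bdpsi := bm_phi_coord i hdpsi.
have bsq j : bounded_measurable (fun y : 'rV[R]_n => y 0 j ^+ 2 * dpsi (y 0 i)).
  by apply: bmM => //; exact: bmM.
have third j : j != i -> exists k, (i != k) && (j != k).
  move=> ji; have : (0 < #|predC (pred2 i j)|)%N.
    rewrite -(ltn_add2l #|pred2 i j|) cardC card_ord addn0 card2 eq_sym.
    by case: (_ != _) => //; exact: ltnW.
  case/card_gt0P => k'; rewrite !inE negb_or => /andP[ki kj].
  by exists k'; rewrite eq_sym ki eq_sym.
have eqj j : j != i -> E (fun y => y 0 j ^+ 2 * dpsi (y 0 i)) =
    E (fun y => y 0 i * psi (y 0 i)).
  move=> ji; have [k' /andP[ik jk]] := third j ji; rewrite eq_sym in ji.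
  have := mean_infinitesimal_rotation ji ik jk.
  rewrite (meanB hsigma)//; last exact: bmM.
  by move/eqP; rewrite subr_eq0 => /eqP.
transitivity (E (fun y => \sum_(j | j != i) y 0 j ^+ 2 * dpsi (y 0 i))).
  rewrite (mean_sum hsigma)// (eq_bigr _ eqj).
  by rewrite sumr_const cardC1 card_ord mulr_natl.
apply: mean_eq => y /usphereP; rewrite /dot (bigD1 i)//= => yy.
rewrite -mulr_suml; congr (_ * _).
rewrite -yy expr2 addrAC subrr add0r.
by apply: eq_bigr => j _; rewrite expr2.
Qed.

End Stein.

(** * Comparison with the uniform distribution *)

Section HingePrimitive.
Context {R : realType}.
Implicit Types (phi : R -> R) (c s t : R).

Lemma bm_itv_cst (a : R) : bm_itv (fun=> a).
Proof. by split; [exact: measurable_cst|exists `|a|]. Qed.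

Lemma bm_itvD phi1 phi2 : bm_itv phi1 -> bm_itv phi2 ->
  bm_itv (fun t => phi1 t + phi2 t).
Proof.
move=> [m1 [K hK]] [m2 [L hL]]; split; first exact: measurable_funD.
by exists (K + L) => t ht; rewrite (le_trans (ler_normD _ _))// lerD ?hK ?hL.
Qed.

Lemma bm_itvM phi1 phi2 : bm_itv phi1 -> bm_itv phi2 ->
  bm_itv (fun t => phi1 t * phi2 t).
Proof.
move=> [m1 [K hK]] [m2 [L hL]]; split; first exact: measurable_funM.
by exists (K * L) => t ht; rewrite normrM ler_pM ?hK ?hL.
Qed.

Lemma bm_itvV phi d : 0 < d -> measurable_fun setT phi -> (forall t, d <= phi t) ->
  bm_itv (fun t => (phi t)^-1).
Proof.
move=> d0 mphi dphi; have phi0 t : 0 < phi t by exact: lt_le_trans (dphi t).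
split.
  have -> : (fun t => (phi t)^-1) = (fun t => phi t `^ (-1)).
    by apply/funext => t; rewrite powR_inv1// ltW.
  exact: (measurableT_comp (measurable_powR (-1)) mphi).
by exists d^-1 => t _; rewrite ger0_norm ?invr_ge0 ?(ltW (phi0 t))// lef_pV2 ?posrE.
Qed.

(** Applied from [s] to [c] and back, the bound makes [dpsi] Lipschitz at [c] with
    constant [2 * K]. Across [c] this costs the cross term
    [2 * K * (t - c) * (c - s)], which completes
    [K * (t - c) ^+ 2 + K * (c - s) ^+ 2] to [K * (t - s) ^+ 2]. *)
Lemma taylor_glue (psi dpsi : R -> R) (K c : R) : 0 <= K ->
  (forall s t, s <= c -> t <= c ->
    `|psi t - psi s - (t - s) * dpsi s| <= K * (t - s) ^+ 2) ->
  (forall s t, c <= s -> c <= t ->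
    `|psi t - psi s - (t - s) * dpsi s| <= K * (t - s) ^+ 2) ->
  forall s t, `|psi t - psi s - (t - s) * dpsi s| <= K * (t - s) ^+ 2.
Proof.
move=> K0 below above.
have lipschitz s : `|dpsi c - dpsi s| <= 2 * K * `|c - s|.
  have [->|sc] := eqVneq s c; first by rewrite !subrr normr0 mulr0.
  have [h1 h2] : `|psi c - psi s - (c - s) * dpsi s| <= K * (c - s) ^+ 2 /\
      `|psi s - psi c - (s - c) * dpsi c| <= K * (s - c) ^+ 2.
    by case: (leP s c) => [h|/ltW h]; split; do [exact: below|exact: above].
  have cs0 : 0 < `|c - s| by rewrite normr_gt0 subr_eq0 eq_sym.
  rewrite -(ler_pM2r cs0) -normrM.
  have -> : 2 * K * `|c - s| * `|c - s| = 2 * K * (c - s) ^+ 2.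
    by rewrite -[(c - s) ^+ 2]real_normK ?num_real//; ring.
  have -> : (dpsi c - dpsi s) * (c - s) = (psi c - psi s - (c - s) * dpsi s) +
      (psi s - psi c - (s - c) * dpsi c) by ring.
  by apply: le_trans (ler_normD _ _) _; lra.
have across s t : 0 <= (t - c) * (c - s) ->
    `|psi c - psi s - (c - s) * dpsi s| <= K * (c - s) ^+ 2 ->
    `|psi t - psi c - (t - c) * dpsi c| <= K * (t - c) ^+ 2 ->
    `|psi t - psi s - (t - s) * dpsi s| <= K * (t - s) ^+ 2.
  move=> pos h1 h2.
  have -> : psi t - psi s - (t - s) * dpsi s = (psi t - psi c - (t - c) * dpsi c) +
      (psi c - psi s - (c - s) * dpsi s) + (t - c) * (dpsi c - dpsi s) by ring.
  have h3 : `|(t - c) * (dpsi c - dpsi s)| <= 2 * K * ((t - c) * (c - s)).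
    rewrite -[X in _ <= _ * X]ger0_norm// !normrM mulrCA.
    by rewrite ler_wpM2l.
  apply: le_trans (ler_normD _ _) _; apply: le_trans (lerD (ler_normD _ _) h3) _.
  lra.
move=> s t; case: (leP s c) => [sc|/ltW cs]; case: (leP t c) => [tc|/ltW ct].
- exact: below.
- apply: across; [by rewrite mulr_ge0// subr_ge0|exact: below|exact: above].
- apply: across; [by rewrite mulr_le0// subr_le0|exact: above|exact: below].
- exact: above.
Qed.

(** The solution [psi] of
    [((1 - t ^+ 2) * psi)' = (1 - c) ^+ 2 / 4 - Num.max (t - c) 0] that is regular at
    both ends of [[-1, 1]]. It is [((1 - c) ^+ 2 / 4) / (1 - t)] below [c] and
    [1 / 2 - ((1 + c) ^+ 2 / 4) / (1 + t)] above; writing it with [Num.min] and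
    [Num.max] keeps the denominators away from zero. *)
Definition hinge_prim c t : R :=
  (1 - c) ^+ 2 / 4 * (1 - Num.min t c)^-1 + (1 + c) / 4
  - (1 + c) ^+ 2 / 4 * (1 + Num.max t c)^-1.

Definition hinge_prim' c t : R :=
  (1 - c) ^+ 2 / 4 * (1 - Num.min t c)^-1 ^+ 2
  + (1 + c) ^+ 2 / 4 * (1 + Num.max t c)^-1 ^+ 2 - 1 / 4.

Variable c : R.
Hypotheses (c_gtN1 : -1 < c) (c_lt1 : c < 1).

Lemma hinge_prim_le t : t <= c -> hinge_prim c t = (1 - c) ^+ 2 / 4 / (1 - t).
Proof.
have gtN1 := c_gtN1; have lt1 := c_lt1.
move=> tc; rewrite /hinge_prim min_l// max_r//.
by field; rewrite !gt_eqF//; lra.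
Qed.

Lemma hinge_prim_ge t : c <= t ->
  hinge_prim c t = 1 / 2 - (1 + c) ^+ 2 / 4 / (1 + t).
Proof.
have gtN1 := c_gtN1; have lt1 := c_lt1.
move=> tc; rewrite /hinge_prim min_r// max_l//.
by field; rewrite !gt_eqF//; lra.
Qed.

Lemma hinge_prim'_le t : t <= c -> hinge_prim' c t = (1 - c) ^+ 2 / 4 / (1 - t) ^+ 2.
Proof.
have gtN1 := c_gtN1; have lt1 := c_lt1.
move=> tc; rewrite /hinge_prim' min_l// max_r//.
by field; rewrite !gt_eqF//; lra.
Qed.

Lemma hinge_prim'_ge t : c <= t -> hinge_prim' c t = (1 + c) ^+ 2 / 4 / (1 + t) ^+ 2.
Proof.
have gtN1 := c_gtN1; have lt1 := c_lt1.
move=> tc; rewrite /hinge_prim' min_r// max_l//.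
by field; rewrite !gt_eqF//; lra.
Qed.

Lemma hinge_prim'_ge0 t : 0 <= hinge_prim' c t.
Proof.
case: (leP t c) => [tc|/ltW tc].
  by rewrite hinge_prim'_le// !divr_ge0// sqr_ge0.
by rewrite hinge_prim'_ge// !divr_ge0// sqr_ge0.
Qed.

Lemma hinge_primE t : `|t| <= 1 ->
  (1 - t ^+ 2) * hinge_prim' c t - 2 * (t * hinge_prim c t) =
  (1 - c) ^+ 2 / 4 - Num.max (t - c) 0.
Proof.
have gtN1 := c_gtN1; have lt1 := c_lt1.
rewrite ler_norml => /andP[t1 t2]; case: (leP t c) => [tc|/ltW tc].
  rewrite hinge_prim_le// hinge_prim'_le// max_r ?subr_le0//.
  by field; rewrite !gt_eqF//; lra.
rewrite hinge_prim_ge// hinge_prim'_ge// max_l ?subr_ge0//.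
by field; rewrite !gt_eqF//; lra.
Qed.

Let u_bm : bm_itv (fun t => (1 - Num.min t c)^-1).
Proof.
have gtN1 := c_gtN1; have lt1 := c_lt1.
apply: (@bm_itvV _ (1 - c)); first by lra.
  apply: measurable_funB; first exact: measurable_cst.
  by apply: measurable_minr; [exact: measurable_id|exact: measurable_cst].
by move=> t; rewrite lerD2l lerN2 ge_min lexx orbT.
Qed.

Let w_bm : bm_itv (fun t => (1 + Num.max t c)^-1).
Proof.
have gtN1 := c_gtN1; have lt1 := c_lt1.
apply: (@bm_itvV _ (1 + c)); first by lra.
  apply: measurable_funD; first exact: measurable_cst.
  by apply: measurable_maxr; [exact: measurable_id|exact: measurable_cst].
by move=> t; rewrite lerD2l le_max lexx orbT.
Qed.

Lemma hinge_prim_bm : bm_itv (hinge_prim c).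
Proof.
apply: bm_itvD; first (apply: bm_itvD; last exact: bm_itv_cst).
  by apply: bm_itvM => //; exact: bm_itv_cst.
have := bm_itvM (bm_itv_cst (- ((1 + c) ^+ 2 / 4))) w_bm.
by congr bm_itv; apply/funext => t; rewrite mulNr.
Qed.

Lemma hinge_prim'_bm : bm_itv (hinge_prim' c).
Proof.
apply: bm_itvD; last exact: bm_itv_cst.
by apply: bm_itvD; (apply: bm_itvM; [exact: bm_itv_cst|exact: bm_itvM]).
Qed.

Let remainder_le (d x y e : R) : 0 < d -> d <= x -> d <= y ->
  `|d ^+ 2 / 4 / (x * y ^+ 2) * e ^+ 2| <= d^-1 * e ^+ 2.
Proof.
move=> d0 dx dy.
have xy : d * d ^+ 2 <= x * y ^+ 2.
  by rewrite ler_pM ?sqr_ge0 ?(ltW d0)// ler_pXn2r ?nnegrE//; lra.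
have xy0 : 0 < x * y ^+ 2.
  by apply: lt_le_trans xy; rewrite mulr_gt0// exprn_gt0.
rewrite ger0_norm; last by rewrite mulr_ge0 ?divr_ge0 ?sqr_ge0 ?(ltW xy0).
rewrite ler_wpM2r ?sqr_ge0// ler_pdivrMr// ler_pdivlMl//.
have : 0 <= d * d ^+ 2 by rewrite mulr_ge0 ?sqr_ge0 ?ltW.
lra.
Qed.

Lemma hinge_prim_taylor s t :
  `|hinge_prim c t - hinge_prim c s - (t - s) * hinge_prim' c s| <=
  ((1 - c)^-1 + (1 + c)^-1) * (t - s) ^+ 2.
Proof.
have gtN1 := c_gtN1; have lt1 := c_lt1.
have c1 : 0 < 1 - c by lra.
have c2 : 0 < 1 + c by lra.
have v1 : 0 <= (1 - c)^-1 by rewrite invr_ge0 ltW.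
have v2 : 0 <= (1 + c)^-1 by rewrite invr_ge0 ltW.
move: s t; apply: (@taylor_glue _ _ _ c); first by rewrite addr_ge0.
  move=> s t sc tc; rewrite !hinge_prim_le// hinge_prim'_le//.
  have -> : (1 - c) ^+ 2 / 4 / (1 - t) - (1 - c) ^+ 2 / 4 / (1 - s) -
      (t - s) * ((1 - c) ^+ 2 / 4 / (1 - s) ^+ 2) =
      (1 - c) ^+ 2 / 4 / ((1 - t) * (1 - s) ^+ 2) * (t - s) ^+ 2.
    by field; rewrite !gt_eqF//; lra.
  apply: le_trans (@remainder_le _ _ _ _ _ _ _) _; [lra|lra|lra|].
  by rewrite ler_wpM2r ?sqr_ge0// lerDl.
move=> s t sc tc; rewrite !hinge_prim_ge// hinge_prim'_ge//.
have -> : 1 / 2 - (1 + c) ^+ 2 / 4 / (1 + t) - (1 / 2 - (1 + c) ^+ 2 / 4 / (1 + s)) -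
    (t - s) * ((1 + c) ^+ 2 / 4 / (1 + s) ^+ 2) =
    - ((1 + c) ^+ 2 / 4 / ((1 + t) * (1 + s) ^+ 2) * (t - s) ^+ 2).
  by field; rewrite !gt_eqF//; lra.
rewrite normrN; apply: le_trans (@remainder_le _ _ _ _ _ _ _) _; [lra|lra|lra|].
by rewrite ler_wpM2r ?sqr_ge0// lerDr.
Qed.

End HingePrimitive.

(** * Linear forms against bounded functions *)

Section GradientBound.
Context {R : realType} {n : nat} (sigma : {measure set (borel_rV R n) -> \bar R}).
Hypotheses (hsigma : is_sphere_measure sigma) (n3 : (3 <= n)%N).
Implicit Types (l : 'rV[R]_n) (f g : 'rV[R]_n -> R).

Local Notation E := (sphere_mean sigma).

Let i0 : 'I_n := Ordinal (ltn_trans (isT : 0 < 2)%N n3).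
Let i1 : 'I_n := Ordinal (ltn_trans (isT : 1 < 2)%N n3).
Let i01 : i0 != i1. Proof. by []. Qed.

Lemma mean_dot l : E (dot l) = 0.
Proof.
have other i : exists k : 'I_n, i != k.
  by have [->|ni] := eqVneq i i0; [exists i1|exists i0].
rewrite /dot (mean_sum hsigma) => [|i _]; last by apply: bmZ; exact: bm_coord.
rewrite big1// => i _; rewrite (meanZ hsigma); last exact: bm_coord.
by have [k ik] := other i; rewrite (mean_coord hsigma ik) mulr0.
Qed.

Lemma bm_itv_hinge (c : R) : bm_itv (fun t => Num.max (t - c) 0).
Proof.
split.
  apply: measurable_maxr; last exact: measurable_cst.
  by apply: measurable_funB; [exact: measurable_id|exact: measurable_cst].
exists (1 + `|c|) => t t1; have tc := ler_normB t c; have c0 := normr_ge0 c.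
by rewrite /Num.max; case: ifP => _; rewrite ?normr0; lra.
Qed.

(** By Stein's identity for [hinge_prim], the right-hand side minus the left-hand
    side is [n - 3] times [E (y 0 i * hinge_prim c (y 0 i))], which is a positive
    multiple of the mean of the nonnegative
    [(1 - y 0 i ^+ 2) * hinge_prim' c (y 0 i)]. At [c = -1] and [c = 1], where
    [hinge_prim] degenerates, the mean is explicit. *)
Lemma mean_hinge_le l (c : R) : usphere R n l -> -1 <= c -> c <= 1 ->
  E (fun y => Num.max (dot l y - c) 0) <= (1 - c) ^+ 2 / 4.
Proof.
move=> hl; rewrite le_eqVlt => /predU1P[<- _|cN1].
  rewrite [leLHS](_ : _ = 1); first by lra.
  transitivity (E (fun y => dot l y + 1)).
    apply: mean_eq => y yS; have := norm_dot_usphere hl yS.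
    by rewrite ler_norml => /andP[h _]; rewrite max_l; lra.
  rewrite (meanD hsigma) ?mean_dot ?mean_cst ?add0r//; first exact: bm_dot.
  exact: bm_cst.
rewrite le_eqVlt => /predU1P[->|c1].
  rewrite [leLHS](_ : _ = 0); first by lra.
  rewrite -[RHS](mean_cst hsigma); apply: mean_eq => y yS.
  have := norm_dot_usphere hl yS.
  by rewrite ler_norml => /andP[_ h]; rewrite max_r; lra.
have bh := bm_itv_hinge c.
rewrite (mean_phi_dot hsigma bh i01 hl).
have bp := hinge_prim_bm cN1 c1; have bp' := hinge_prim'_bm cN1 c1.
have K0 : 0 <= (1 - c)^-1 + (1 + c)^-1 by rewrite addr_ge0// invr_ge0; lra.
have stein := mean_stein hsigma bp bp' K0
  (fun s t _ _ => hinge_prim_taylor cN1 c1 s t) i0 n3.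
set S := E (fun y => _ * hinge_prim' _ _) in stein.
set T := E (fun y => _ * hinge_prim _ _) in stein.
have S0 : 0 <= S.
  apply: mean_ge0 => // y yS; rewrite mulr_ge0 ?hinge_prim'_ge0// subr_ge0.
  by rewrite -real_normK ?num_real// exprn_ile1// norm_coord_usphere.
have T0 : 2 * T <= S.
  have n2 : 2 <= n.-1%:R :> R by rewrite ler_nat -ltnS prednK// ltnW// ltnW.
  have T0 : 0 <= T.
    by move: S0; rewrite -stein pmulr_rge0//; apply: lt_le_trans n2.
  by rewrite -stein ler_wpM2r.
have bi := @bm_coord R n i0.
have bpi := bm_phi_coord i0 bp; have bpi' := bm_phi_coord i0 bp'.
have bhi := bm_phi_coord i0 bh.
have bTm : bounded_measurable (fun y : 'rV[R]_n => y 0 i0 * hinge_prim c (y 0 i0)).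
  exact: bmM.
have bSm : bounded_measurable
    (fun y : 'rV[R]_n => (1 - y 0 i0 ^+ 2) * hinge_prim' c (y 0 i0)).
  by apply: bmM => //; apply: bmB; [exact: bm_cst|exact: bmM].
have : E (fun y => (1 - y 0 i0 ^+ 2) * hinge_prim' c (y 0 i0) -
    2 * (y 0 i0 * hinge_prim c (y 0 i0))) =
    E (fun y => (1 - c) ^+ 2 / 4 - Num.max (y 0 i0 - c) 0).
  by apply: mean_eq => y yS; rewrite hinge_primE// norm_coord_usphere.
rewrite (meanB hsigma)//; last exact: bmZ.
rewrite (meanZ hsigma)// (meanB hsigma)//; last exact: bm_cst.
rewrite (mean_cst hsigma) -/S -/T; lra.
Qed.

(** A bathtub argument: [g] is traded for the superlevel set of [dot l] at
    the height [c = 1 - 2 m], which has measure [m] for the uniform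
    distribution. *)
Lemma mean_dot_le l g : usphere R n l -> bounded_measurable g ->
  (forall y, usphere R n y -> 0 <= g y <= 1) ->
  E (fun y => dot l y * g y) <= E g * (1 - E g).
Proof.
move=> hl bg g01; set m := E g.
have m0 : 0 <= m by apply: mean_ge0 => // y /g01 /andP[].
have m1 : m <= 1.
  rewrite -[leRHS](mean_cst hsigma); apply: mean_le => // [|y /g01 /andP[]//].
  exact: bm_cst.
pose c := 1 - 2 * m.
have hinge : E (fun y => Num.max (dot l y - c) 0) <= (1 - c) ^+ 2 / 4.
  by apply: mean_hinge_le => //; rewrite /c; lra.
have bl := bm_dot l; have bh := bm_phi_dot (bm_itv_hinge c) hl.
have : E (fun y => dot l y * g y) <= E (fun y => Num.max (dot l y - c) 0 + c * g y).
  apply: mean_le => //; [exact: bmM|by apply: bmD => //; exact: bmZ|].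
  move=> y /g01 /andP[g0 g1].
  suff : (dot l y - c) * g y <= Num.max (dot l y - c) 0 by lra.
  by rewrite /Num.max; case: ltP => h; nra.
rewrite (meanD hsigma)//; last exact: bmZ.
rewrite (meanZ hsigma)// -/m => h; apply: le_trans h _.
apply: le_trans (lerD hinge (lexx _)) _.
by rewrite /c le_eqVlt; apply/orP; left; apply/eqP; field.
Qed.

(** [mean_dot_le] for [g = (1 - f) / 2] and the opposite direction [- l]. *)
Lemma mean_dot_boundary_le l f : usphere R n l -> boundary_data f ->
  2 * E (fun y => dot l y * f y) <= 1 - E f ^+ 2.
Proof.
move=> hl hf; have bf := boundary_data_bm hf; have [_ f1] := hf.
pose g y := (1 - f y) / 2.
have gE : g = fun y => 2^-1 - 2^-1 * f y by apply/funext => y; rewrite /g; field.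
have bg : bounded_measurable g.
  by rewrite gE; apply: bmB; [exact: bm_cst|exact: bmZ].
have Eg : E g = 2^-1 - 2^-1 * E f.
  rewrite gE (meanB hsigma) ?(mean_cst hsigma) ?(meanZ hsigma)//; last exact: bmZ.
  exact: bm_cst.
have := @mean_dot_le (- l) g (usphereN hl) bg.
have -> : E (fun y => dot (- l) y * g y) = 2^-1 * E (fun y => dot l y * f y).
  have bl := bm_dot l; have blf := bmM bl bf.
  transitivity (E (fun y => 2^-1 * (dot l y * f y) - 2^-1 * dot l y)).
    by apply: mean_eq => y _; rewrite -scaleN1r dotZl /g; field.
  rewrite (meanB hsigma) ?(meanZ hsigma) ?mean_dot ?mulr0 ?subr0//; exact: bmZ.
rewrite Eg => h.
have : 2^-1 * E (fun y => dot l y * f y) <=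
    (2^-1 - 2^-1 * E f) * (1 - (2^-1 - 2^-1 * E f)).
  by apply: h => y /f1 /andP[f0 f2]; rewrite /g; apply/andP; split; lra.
have -> : (2^-1 - 2^-1 * E f) * (1 - (2^-1 - 2^-1 * E f)) =
    (1 - E f ^+ 2) / 4 by field.
lra.
Qed.

End GradientBound.

(** * The extension near the origin *)

Section Expansion.
Context {R : realType}.

Lemma powR_expansion (r eps : R) : 0 < eps -> exists2 delta : R, 0 < delta &
  forall u, `|u| < delta -> `|(1 + u) `^ r - 1 - r * u| <= eps * `|u|.
Proof.
move=> eps0.
have [dr dE] : is_derive (1 : R) (1 : R) (@powR R ^~ r) (r * 1 `^ (r - 1)).
  exact: is_derive1_powR.
rewrite powR1 mulr1 in dE.
move: dr; rewrite /derivable => dr.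
have : h^-1 *: (((fun a => a `^ r) \o shift 1) (h *: 1) - 1 `^ r) @[h --> 0^'] --> r.
  by rewrite -[X in _ --> X]dE; exact: dr.
move=> /cvgrPdist_le /(_ _ eps0) /nbhs_ballP [d /= d0 hd].
exists d => // u ud; have [->|u0] := eqVneq u 0.
  by rewrite addr0 powR1 mulr0 !subrr normr0 mulr0.
have := hd u; rewrite /ball/= sub0r normrN => /(_ ud u0).
rewrite powR1 /shift/= /GRing.scale/= mulr1 => h.
have un : 0 < `|u| by rewrite normr_gt0.
rewrite -ler_pdivrMr// -normfV -normrM -normrN; apply: le_trans h.
rewrite le_eqVlt; apply/orP; left; apply/eqP; congr `|_|.
by rewrite (addrC u 1); field.
Qed.

End Expansion.

Section Kernel.
Context {R : realType} {n : nat}.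
Variables (alpha beta : R).
Implicit Types x y : 'rV[R]_n.

Lemma poisson_kernelE x y : usphere R n y ->
  poisson_kernel alpha beta x y =
  (1 - dot x x) `^ alpha * (1 + (dot x x - 2 * dot x y)) `^ (- beta).
Proof.
move=> /usphereP yy; rewrite /poisson_kernel sqr_enorm powRN powRrM.
rewrite (powR_mulrn 2%N) ?enorm_ge0// sqr_enorm; congr (_ / _ `^ _).
by rewrite dotBl !dotBr yy (dotC y x); ring.
Qed.

Lemma poisson_kernel0 y : usphere R n y -> poisson_kernel alpha beta 0 y = 1.
Proof.
move=> hy; have d0 z : dot (0 : 'rV[R]_n) z = 0.
  by rewrite /dot big1// => i _; rewrite mxE mul0r.
by rewrite poisson_kernelE// !d0 !(mulr0, subr0, addr0) !powR1 mulr1.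
Qed.

(** Uniformity in [y] comes from [|x - y|^2 = 1 + u] with [u = |x|^2 - 2 x . y] and
    [|u| <= 3 |x|], so that only the derivatives of two powers at [1] matter. *)
Lemma poisson_kernel_expansion (eps : R) : 0 < beta -> 0 < eps ->
  exists2 delta : R, 0 < delta & forall x y, enorm x < delta -> usphere R n y ->
  `|poisson_kernel alpha beta x y - 1 - 2 * beta * dot x y| <= eps * enorm x.
Proof.
move=> beta0 eps0.
(* [C * enorm x ^+ 2] collects the second-order terms: [`|alpha| + 1] bounds the
   first factor of the kernel minus [1], and [4 + 3 * beta] its second factor. *)
pose C := (`|alpha| + 1) * (4 + 3 * beta) + beta.
have alpha0 := normr_ge0 alpha.
have C0 : 0 < C by rewrite /C; nra.
have [d1 d10 h1] := powR_expansion alpha ltr01.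
have eps2 : 0 < Num.min 1 (eps / 6) by rewrite lt_min ltr01; lra.
have [d2 d20 h2] := powR_expansion (- beta) eps2.
set e2 := Num.min 1 (eps / 6) in eps2 h2.
have e21 : e2 <= 1 by rewrite ge_min lexx.
have e26 : e2 <= eps / 6 by rewrite ge_min lexx orbT.
exists (Num.min (Num.min 1 d1) (Num.min (d2 / 3) (eps / (2 * C)))).
  by rewrite !lt_min ltr01 d10 !divr_gt0 ?mulr_gt0.
move=> x y; rewrite !lt_min => /andP[/andP[x1 xd1] /andP[xd2 xC]] yS.
rewrite poisson_kernelE// -sqr_enorm.
set e := enorm x in x1 xd1 xd2 xC *; have e0 : 0 <= e := enorm_ge0 x.
have xy : `|dot x y| <= e by have := norm_dot_le x y; rewrite yS mulr1.
set t := dot x y in xy *.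
have ee : e ^+ 2 <= e by nra.
have ee0 : 0 <= e ^+ 2 by rewrite sqr_ge0.
have {}xC : C * e ^+ 2 <= eps / 2 * e.
  move: xC; rewrite ltr_pdivlMr ?mulr_gt0// => xC; nra.
have hA : `|(1 - e ^+ 2) `^ alpha - 1| <= (`|alpha| + 1) * e ^+ 2.
  have := h1 (- e ^+ 2); rewrite normrN ger0_norm// => /(_ (le_lt_trans ee xd1)) h.
  have -> : (1 - e ^+ 2) `^ alpha - 1 =
      ((1 - e ^+ 2) `^ alpha - 1 - alpha * - e ^+ 2) - alpha * e ^+ 2 by ring.
  apply: le_trans (ler_normB _ _) _; rewrite normrM (ger0_norm ee0); lra.
set A := (1 - e ^+ 2) `^ alpha in hA *.
set u := e ^+ 2 - 2 * t.
have u3 : `|u| <= 3 * e.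
  apply: le_trans (ler_normB _ _) _.
  by rewrite (ger0_norm ee0) normrM (@ger0_norm _ 2)//; lra.
have hB : `|(1 + u) `^ (- beta) - 1 - 2 * beta * t| <= 3 * e2 * e + beta * e ^+ 2.
  have := h2 u; have ud2 : `|u| < d2 by lra.
  move=> /(_ ud2) h.
  have -> : (1 + u) `^ (- beta) - 1 - 2 * beta * t =
    ((1 + u) `^ (- beta) - 1 - - beta * u) - beta * e ^+ 2 by rewrite /u; ring.
  apply: le_trans (ler_normB _ _) _; rewrite normrM (ger0_norm ee0) (gtr0_norm beta0).
  nra.
set B := (1 + u) `^ (- beta) in hB *.
have nB : `|B| <= 4 + 3 * beta.
  have -> : B = (B - 1 - 2 * beta * t) + (1 + 2 * beta * t) by ring.
  apply: le_trans (ler_normD _ _) _.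
  have : `|1 + 2 * beta * t| <= 1 + 2 * beta * e.
    apply: le_trans (ler_normD _ _) _.
    rewrite normr1 normrM (@ger0_norm _ (2 * beta)) ?mulr_ge0 ?(ltW beta0)//.
    by rewrite lerD2l ler_wpM2l// mulr_ge0// ltW.
  nra.
have -> : A * B - 1 - 2 * beta * t = (A - 1) * B + (B - 1 - 2 * beta * t) by ring.
apply: le_trans (ler_normD _ _) _; rewrite normrM.
have : `|A - 1| * `|B| <= (`|alpha| + 1) * e ^+ 2 * (4 + 3 * beta) by rewrite ler_pM.
have : e2 * e <= eps / 6 * e by rewrite ler_wpM2r.
rewrite /C in xC; lra.
Qed.

End Kernel.

Lemma differentiable_of_remainder (R : realType) (V W : normedModType R)
    (F : V -> W) (df : {linear V -> W}) (x : V) : continuous df ->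
  (forall eps : R, 0 < eps ->
    \forall v \near (0 : V), `|F (v + x) - F x - df v| <= eps * `|v|) ->
  differentiable F x /\ 'd F x = df :> (V -> W).
Proof.
move=> cdf hF.
have exp0 : F \o shift x = cst (F x) + df +o_ 0 id.
  apply/eqaddoP => eps eps0; apply: filterS (hF eps eps0) => v.
  by rewrite !fctE /= opprD addrA.
have dE := diff_unique cdf exp0.
by split => //; apply/diff_locallyP; rewrite dE.
Qed.

Section Derivative.
Context {R : realType} {n : nat} (sigma : {measure set (borel_rV R n) -> \bar R}).
Hypothesis hsigma : is_sphere_measure sigma.
Variables (alpha beta : R) (f : 'rV[R]_n -> R).
Hypotheses (beta0 : 0 < beta) (hf : boundary_data f).
Implicit Types x y l : 'rV[R]_n.

Local Notation E := (sphere_mean sigma).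
Local Notation h := (poisson_ext sigma alpha beta f).

Definition first_moment : 'rV[R]_n := \row_i E (fun y => y 0 i * f y).

Let bf : bounded_measurable f. Proof. exact: boundary_data_bm. Qed.

Lemma dot_first_moment l : dot l first_moment = E (fun y => dot l y * f y).
Proof.
have bi i : bounded_measurable (fun y => y 0 i * f y).
  by apply: bmM => //; exact: bm_coord.
transitivity (E (fun y => \sum_i l 0 i * (y 0 i * f y))).
  rewrite (mean_sum hsigma) => [|i _]; last exact: bmZ.
  by apply: eq_bigr => i _; rewrite mxE (meanZ hsigma).
apply: mean_eq => y _; rewrite mulr_suml.
by apply: eq_bigr => i _; rewrite mulrA.
Qed.

Lemma poisson_ext0 : h 0 = E f.
Proof. by apply: mean_eq => y yS; rewrite poisson_kernel0// mul1r. Qed.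

Lemma bm_poisson_kernel x (K : R) :
  (forall y, usphere R n y -> `|poisson_kernel alpha beta x y| <= K) ->
  bounded_measurable (poisson_kernel alpha beta x).
Proof.
move=> hK; split; last by exists K.
pose P y := (1 - dot x x) `^ alpha * (1 + (dot x x - 2 * dot x y)) `^ (- beta).
apply: (@eq_measurable_fun _ _ (borel_rV R n) _ (usphere R n) P).
  by move=> y; rewrite inE => yS; rewrite poisson_kernelE.
apply: measurable_funM; first exact: measurable_cst.
apply: (measurableT_comp (measurable_powR (- beta))).
apply: measurable_funD; first exact: measurable_cst.
apply: measurable_funB; first exact: measurable_cst.
apply: measurable_funM; first exact: measurable_cst.
exact: (measurable_funTS (measurable_dot x)).
Qed.

Lemma poisson_ext_expansion (eps : R) : 0 < eps ->
  exists2 delta : R, 0 < delta & forall x, enorm x < delta ->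
  `|h x - h 0 - 2 * beta * dot x first_moment| <= eps * enorm x.
Proof.
move=> eps0; have [_ f1] := hf.
have [d d0 hd] := @poisson_kernel_expansion R n alpha beta eps beta0 eps0.
exists d => // x xd.
have bl := bm_dot x.
have bP : bounded_measurable (poisson_kernel alpha beta x).
  apply: (@bm_poisson_kernel _ (eps * enorm x + (1 + 2 * beta * enorm x))) => y yS.
  have -> : poisson_kernel alpha beta x y = (poisson_kernel alpha beta x y - 1 -
      2 * beta * dot x y) + (1 + 2 * beta * dot x y) by ring.
  apply: le_trans (ler_normD _ _) _; apply: lerD; first exact: hd.
  apply: le_trans (ler_normD _ _) _; rewrite normr1 lerD2l normrM.
  have b0 : 0 <= 2 * beta by rewrite mulr_ge0// ltW.
  rewrite (ger0_norm b0) ler_wpM2l//.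
  by have := norm_dot_le x y; rewrite yS mulr1.
have bPf := bmM bP bf; have blf := bmM bl bf.
rewrite poisson_ext0 dot_first_moment.
have -> : h x - E f - 2 * beta * E (fun y => dot x y * f y) =
    E (fun y => poisson_kernel alpha beta x y * f y - f y -
      2 * beta * (dot x y * f y)).
  rewrite (meanB hsigma); [|exact: bmB|exact: bmZ].
  by rewrite (meanB hsigma)// (meanZ hsigma).
apply: norm_mean_le => //; first by apply: bmB; [exact: bmB|exact: bmZ].
move=> y yS.
have -> : poisson_kernel alpha beta x y * f y - f y - 2 * beta * (dot x y * f y) =
  (poisson_kernel alpha beta x y - 1 - 2 * beta * dot x y) * f y by ring.
rewrite normrM -[leRHS]mulr1 ler_pM//; first exact: hd.
by rewrite ler_norml f1.
Qed.

Lemma poisson_ext_diff :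
  differentiable h 0 /\ forall v, 'd h 0 v = 2 * beta * dot v first_moment.
Proof.
pose L v : R := 2 * beta * dot v first_moment.
have linL : linear L by move=> a u v; rewrite /L dotDl dotZl /= /GRing.scale/=; ring.
pose df : {linear 'rV[R]_n -> R} := HB.pack L (GRing.isLinear.Build _ _ _ _ L linL).
have dfE v : df v = L v by [].
have cdf : continuous df.
  have -> : (df : _ -> _) =
      fun v => \sum_i v 0 i *: (2 * beta * first_moment 0 i : R).
    apply/funext => v; rewrite dfE /L /dot mulr_sumr; apply: eq_bigr => i _.
    by rewrite /GRing.scale/=; ring.
  apply: continuous_big => [|i _]; first exact: add_continuous.
  exact: (fun x => cvgZr_tmp (@coord_continuous R 1 n 0 i x)).
have [|dh dhE] := @differentiable_of_remainder _ _ _ h df 0 cdf.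
  move=> eps eps0.
  have n0 : 0 < n%:R + 1 :> R by rewrite ltr_wpDl.
  have [d d0 hd] := poisson_ext_expansion (divr_gt0 eps0 n0).
  apply/nbhs_ballP; exists (d / (n%:R + 1)) => /=; first by rewrite divr_gt0.
  move=> x; rewrite -ball_normE /= sub0r normrN ltr_pdivlMr// mulrC => xd.
  rewrite addr0; apply: le_trans (hd x (le_lt_trans (enorm_le_norm x) xd)) _.
  rewrite -mulrA ler_wpM2l ?(ltW eps0)// ler_pdivrMl//.
  exact: enorm_le_norm.
by split => // v; rewrite dhE.
Qed.

Lemma gradient_poisson_ext : gradient h 0 = (2 * beta) *: first_moment.
Proof.
have [dh dhE] := poisson_ext_diff.
apply/rowP => i; rewrite [LHS]mxE deriveE// dhE dotC dot_delta.
by rewrite [RHS]mxE.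
Qed.

End Derivative.

(** * Caps and sharpness *)

Section Caps.
Context {R : realType} {n : nat} (sigma : {measure set (borel_rV R n) -> \bar R}).
Hypotheses (hsigma : is_sphere_measure sigma) (n3 : (3 <= n)%N).

Local Notation E := (sphere_mean sigma).

Let i0 : 'I_n := Ordinal (ltn_trans (isT : 0 < 2)%N n3).
Let i1 : 'I_n := Ordinal (ltn_trans (isT : 1 < 2)%N n3).
Let i01 : i0 != i1. Proof. by []. Qed.

(** The value at [0] is an arbitrary unit vector, so that [normalize] always lands
    on the sphere. *)
Definition normalize (q : 'rV[R]_n) : 'rV[R]_n :=
  if q == 0 then delta_mx 0 i0 else (enorm q)^-1 *: q.

Lemma normalize_usphere q : usphere R n (normalize q).
Proof.
rewrite /normalize; case: eqVneq => [_|q0]; first exact: usphere_delta.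
apply/usphereP; rewrite dotZl dotZr -sqr_enorm.
by have := enorm_gt0 q0 => /lt0r_neq0 ?; field.
Qed.

Definition grid_vector (N : nat) (t : {ffun 'I_n -> 'I_(2 * N).+1}) : 'rV[R]_n :=
  \row_i ((t i)%:R - N%:R).

(** Rounding [N%:R *: y] down to an integer vector moves it by at most [n] in
    the direction of [y] and increases its length by at most [n]. *)
Lemma grid_caps_cover (s : R) : 0 <= s -> s < 1 -> exists N : nat,
  forall y, usphere R n y ->
  exists t : {ffun 'I_n -> 'I_(2 * N).+1}, s < dot (normalize (grid_vector t)) y.
Proof.
move=> s0 s1; pose N := (Num.truncn (2 * n%:R / (1 - s))).+1.
have hN : n%:R * (1 + s) < N%:R * (1 - s).
  have h : 2 * n%:R / (1 - s) < N%:R by rewrite /N truncnS_gt.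
  rewrite ltr_pdivrMr in h; last by lra.
  apply: le_lt_trans h; have := ler0n R n; nra.
have nN : n%:R < N%:R :> R by have := ler0n R n; have := ler0n R N; nra.
exists N => y yS; have /usphereP yy := yS.
pose z i : R := N%:R * y 0 i + N%:R.
have z0 i : 0 <= z i /\ z i <= (2 * N)%:R.
  have := norm_coord_usphere i yS; rewrite ler_norml => /andP[y1 y2].
  by rewrite /z natrM; have := ler0n R N; split; nra.
have zlt i : (Num.truncn (z i) < (2 * N).+1)%N.
  have [z1 z2] := z0 i; rewrite -(ltr_nat R) -natr1.
  have := truncn_le (z i); rewrite z1 => h; apply: le_lt_trans h _.
  by apply: le_lt_trans z2 _; rewrite ltrDl.
pose t := [ffun i => Ordinal (zlt i)] : {ffun 'I_n -> 'I_(2 * N).+1}.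
exists t; set q := grid_vector t.
pose r i : R := z i - (Num.truncn (z i))%:R.
have r01 i : 0 <= r i /\ r i <= 1.
  have [z1 z2] := z0 i; rewrite /r; have := truncn_itv z1 => /andP[h1 h2].
  by rewrite -natr1 in h2; split; lra.
have qE i : q 0 i = N%:R * y 0 i - r i by rewrite /q !mxE ffunE/= /r /z; ring.
have ry : `|\sum_i r i * y 0 i| <= n%:R.
  apply: le_trans (ler_norm_sum _ _ _) _.
  rewrite -[X in _ <= X%:R]card_ord -sum1_card natr_sum; apply: ler_sum => i _.
  have [r0 r1] := r01 i; rewrite normrM ger0_norm// -[leRHS]mulr1.
  by rewrite ler_pM// norm_coord_usphere.
have rr : \sum_i r i ^+ 2 <= n%:R.
  rewrite -[X in _ <= X%:R]card_ord -sum1_card natr_sum; apply: ler_sum => i _.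
  by have [r0 r1] := r01 i; rewrite exprn_ile1.
move: ry; rewrite ler_norml => /andP[ry1 ry2].
set ry := \sum_i r i * y 0 i in ry1 ry2.
have qy : dot q y = N%:R - ry.
  transitivity (\sum_i (N%:R * (y 0 i * y 0 i) - r i * y 0 i)).
    by apply: eq_bigr => i _; rewrite qE; ring.
  by rewrite sumrB -mulr_sumr -/(dot y y) yy mulr1.
have qq : dot q q = N%:R ^+ 2 - 2 * N%:R * ry + \sum_i r i ^+ 2.
  transitivity (\sum_i (N%:R ^+ 2 * (y 0 i * y 0 i) - 2 * N%:R * (r i * y 0 i)
      + r i ^+ 2)); first by apply: eq_bigr => i _; rewrite qE; ring.
  by rewrite big_split/= sumrB -!mulr_sumr -/(dot y y) yy mulr1.
have N0 := ler0n R N; have n0 := ler0n R n.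
have q0 : q != 0.
  apply: contraTneq nN => q0; rewrite -leNgt; move: qy.
  by rewrite q0 -(scale0r 0) dotZl mul0r => qy; lra.
have qN : enorm q <= N%:R + n%:R.
  rewrite -(@ler_pXn2r _ 2)// ?nnegrE ?enorm_ge0 ?addr_ge0//.
  have n1 : 1 <= n%:R :> R by rewrite ler1n (leq_trans _ n3).
  by rewrite sqr_enorm qq; nra.
rewrite /normalize (negbTE q0) dotZl mulrC ltr_pdivlMr ?enorm_gt0// qy.
have : s * enorm q <= s * (N%:R + n%:R) by rewrite ler_wpM2l.
lra.
Qed.

Lemma bm_itv_step (s : R) : bm_itv (fun t : R => (s < t)%R%:R : R).
Proof.
split; last by exists 1 => t _; case: (s < t); rewrite ?normr0 ?normr1.
have -> : (fun t : R => (s < t)%R%:R : R) = (fun t => if s < t then 1 else 0).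
  by apply/funext => t; case: (s < t).
apply: measurable_fun_ifT; [|exact: measurable_cst|exact: measurable_cst].
by apply: measurable_fun_ltr; [exact: measurable_cst|exact: measurable_id].
Qed.

(** All caps of the same height have the same measure, and finitely many of
    them cover the sphere. *)
Lemma cap_gt0 (s : R) l : 0 <= s -> s < 1 -> usphere R n l ->
  0 < E (fun y => (s < dot l y)%R%:R).
Proof.
move=> s0 s1 hl; have [N cover] := grid_caps_cover s0 s1.
have bs := bm_itv_step s.
pose v t := normalize (@grid_vector N t).
have bv t : bounded_measurable (fun y => (s < dot (v t) y)%R%:R : R).
  exact: (bm_phi_dot bs (normalize_usphere _)).
have same t : E (fun y => (s < dot (v t) y)%R%:R) = E (fun y => (s < dot l y)%R%:R).
  rewrite (mean_phi_dot hsigma bs i01 (normalize_usphere _)).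
  by rewrite (mean_phi_dot hsigma bs i01 hl).
have : 1 <= \sum_t E (fun y => (s < dot (v t) y)%R%:R).
  rewrite -(mean_sum hsigma)// -[leLHS](mean_cst hsigma).
  apply: mean_le => //; [exact: bm_cst|by apply: bm_sum|] => y yS.
  have [t st] := cover y yS; rewrite (bigD1 t)//= /v st lerDl.
  by apply: sumr_ge0 => u _; exact: ler0n.
rewrite (eq_bigr _ (fun t _ => same t)) sumr_const -mulr_natr => h.
rewrite lt_def; apply/andP; split.
  by apply: contraTneq h => ->; rewrite mul0r -ltNge.
by apply: mean_ge0 => // y _; exact: ler0n.
Qed.

End Caps.

Section Extremal.
Context {R : realType} {n : nat} (sigma : {measure set (borel_rV R n) -> \bar R}).
Hypotheses (hsigma : is_sphere_measure sigma) (n3 : (3 <= n)%N).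
Implicit Types (f : 'rV[R]_n -> R).

Local Notation E := (sphere_mean sigma).

Lemma sqr_mean_le1 f : boundary_data f -> E f ^+ 2 <= 1.
Proof.
move=> hf; have [_ f1] := hf; rewrite -real_normK ?num_real// exprn_ile1//.
apply: norm_mean_le => //; first exact: boundary_data_bm.
by move=> y /f1; rewrite ler_norml.
Qed.

(** [mean_dot_boundary_le] in the direction of the first moment itself. *)
Lemma first_moment_le f : boundary_data f ->
  2 * enorm (first_moment sigma f) <= 1 - E f ^+ 2.
Proof.
move=> hf; set G := first_moment sigma f.
have [->|G0] := eqVneq G 0.
  rewrite -(scale0r 0) enormZ// mul0r mulr0 subr_ge0; exact: sqr_mean_le1.
have hl := @normalize_usphere R n n3 G.
have := mean_dot_boundary_le hsigma n3 hl hf.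
rewrite -(dot_first_moment hsigma hf) /normalize (negbTE G0) dotZl -sqr_enorm.
by rewrite expr2 mulKf// gt_eqF// enorm_gt0.
Qed.

(** The function [1 - 2 g] with [g] the indicator of a cap is nearly extremal: on
    the cap [dot l y] is at least [s], and the constant [1] has no first moment. *)
Lemma cap_data (s : R) l : 0 <= s -> s < 1 -> usphere R n l ->
  exists2 f, boundary_data f & exists m, [/\ 0 < m <= 1, E f = 1 - 2 * m &
    2 * s * m <= enorm (first_moment sigma f)].
Proof.
move=> s0 s1 hl; pose g (y : 'rV[R]_n) : R := (s < dot l y)%R%:R.
have bg : bounded_measurable g by exact: (bm_phi_dot (bm_itv_step s) hl).
have g01 y : 0 <= g y <= 1 by rewrite /g; case: (s < _); rewrite ?lexx ler01.
pose f y := 1 - 2 * g y.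
have bf : bounded_measurable f by apply: bmB; [exact: bm_cst|exact: bmZ].
have hf : boundary_data f.
  split; first by case: bf.
  by move=> y _; have /andP[h1 h2] := g01 y; rewrite /f; apply/andP; split; lra.
have bl := bm_dot l; have blg := bmM bl bg; have blf := bmM bl bf.
exists f => //; exists (E g); split.
- apply/andP; split; first exact: cap_gt0.
  rewrite -[leRHS](mean_cst hsigma); apply: mean_le => //; first exact: bm_cst.
  by move=> y _; have /andP[] := g01 y.
- rewrite (meanB hsigma) ?(mean_cst hsigma) ?(meanZ hsigma)//; last exact: bmZ.
  exact: bm_cst.
- have h1 : s * E g <= E (fun y => dot l y * g y).
    rewrite -(meanZ hsigma)//; apply: mean_le => // [|y _]; first exact: bmZ.
    by rewrite /g; case: ltP => [/ltW|_]; rewrite ?mulr1 ?mulr0.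
  have h2 : E (fun y => dot l y * f y) = - (2 * E (fun y => dot l y * g y)).
    transitivity (E (fun y => dot l y - 2 * (dot l y * g y))).
      by apply: mean_eq => y _; rewrite /f; ring.
    by rewrite (meanB hsigma) ?(meanZ hsigma) ?mean_dot ?sub0r//; exact: bmZ.
  have := norm_dot_le l (first_moment sigma f); rewrite hl mul1r.
  rewrite (dot_first_moment hsigma hf) h2 normrN => h.
  apply: le_trans h; apply: le_trans (ler_norm _); lra.
Qed.

End Extremal.

Theorem theorem2p4 (R : realType) (n : nat) (hn : (3 <= n)%N)
  (sigma : {measure set (borel_rV R n) -> \bar R})
  (hsigma : is_sphere_measure sigma)
  (alpha beta : R) (hbeta : 0 < beta) :
  (forall hstar : 'rV[R]_n -> R, boundary_data hstar ->
     let h := poisson_ext sigma alpha beta hstar in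
     differentiable h 0 /\
     enorm (gradient h 0) <= beta * (1 - `|h 0| ^+ 2)) /\
  (forall C : R, C < beta ->
     ~ (forall hstar : 'rV[R]_n -> R, boundary_data hstar ->
          let h := poisson_ext sigma alpha beta hstar in
          enorm (gradient h 0) <= C * (1 - `|h 0| ^+ 2))).
Proof.
have b2 : 0 <= 2 * beta by rewrite mulr_ge0// ltW.
split => [f hf h|C Cbeta bound].
  split; first by have [] := poisson_ext_diff hsigma alpha hbeta hf.
  rewrite /h (gradient_poisson_ext hsigma alpha hbeta hf) enormZ//.
  rewrite real_normK ?num_real// (poisson_ext0 sigma).
  by rewrite [2 * beta]mulrC -mulrA ler_wpM2l ?(ltW hbeta)// first_moment_le.
(* A negative [C] may be replaced by [0]. *)
pose C' := Num.max C 0.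
have C'0 : 0 <= C' by rewrite le_max lexx orbT.
have C'beta : C' < beta by rewrite gt_max Cbeta hbeta.
(* The height [s] is chosen such that [C' < beta * s < beta]. *)
pose s := (C' + beta) / (2 * beta).
have bb : 0 < 2 * beta by lra.
have s0 : 0 <= s by rewrite divr_ge0//; lra.
have s1 : s < 1 by rewrite ltr_pdivrMr// mul1r; lra.
have sC : C' < beta * s.
  have -> : beta * s = (C' + beta) / 2 by rewrite /s; field; rewrite gt_eqF.
  lra.
have i : 'I_n by exact: Ordinal (ltn_trans (isT : 0 < 2)%N hn).
have [f hf [m [/andP[m0 m1] Ef G]]] := cap_data hsigma hn s0 s1 (usphere_delta i).
have := bound f hf; rewrite /= (gradient_poisson_ext hsigma alpha hbeta hf) enormZ//.
rewrite real_normK ?num_real// (poisson_ext0 sigma) Ef => h.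
have {}h : 2 * beta * enorm (first_moment sigma f) <= C' * (1 - (1 - 2 * m) ^+ 2).
  by apply: le_trans h _; rewrite ler_wpM2r ?le_max ?lexx//; nra.
have h2 : 2 * beta * (2 * s * m) <= 2 * beta * enorm (first_moment sigma f).
  by rewrite ler_wpM2l.
have h3 : C' * m < beta * s * m by rewrite ltr_pM2r.
have h4 : 0 <= C' * m ^+ 2 by rewrite mulr_ge0// sqr_ge0.
lra.
Qed.
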